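(* Let $0<a<b<\infty$ and, for $t\in[a,b]$, let $\pi_t(x)=te^{-tx}$, $x\in\mathbb{R}_+$, be the exponential density (with respect to Lebesgue measure on $\mathbb{R}_+$). Let $C>(b-a)^{-1/2}$ and $\alpha>1$. Then there exists $C^*>0$ such that, as $n\to\infty$, $$\inf_{\hat f\in\mathcal{S}_n}\ \sup_{f\in\tilde{\mathcal{C}}(\alpha,C)\cap\mathbb{H}_1}\pi_f^{\otimes n}\|\hat f-f\|_{\mathbb{H}}^2\ \ge\ C^*(\log n)^{-2\alpha}(1+o(1)).$$
   Context: $\mathbb{H}=L^2([a,b])$; $\mathbb{H}_1=\{f\in\mathbb{H}:f\ge0,\ \int_a^bf(t)\,dt=1\}$. For $f\in\mathbb{H}_1$, $\pi_f(x)=\int_a^bf(t)\pi_t(x)\,dt$ is the mixture density and $\pi_f^{\otimes n}$ denotes the joint distribution of $n$ i.i.d. observations with density $\pi_f$; $\pi_f^{\otimes n}\|\hat f-f\|^2_{\mathbb{H}}$ is the expectation of $\|\hat f(X_1,\dots,X_n)-f\|_{\mathbb{H}}^2$ under it. $\mathcal{S}_n$ is the set of all Borel functions from $\mathbb{R}^n$ to $\mathbb{H}$. For $r\in\mathbb{N}^*$, $h\in\mathbb{R}$ and $f:[a,b]\to\mathbb{R}$, let $\Delta_h^r(f,x)=\sum_{i=0}^r\binom{r}{i}(-1)^if(x+(i-r/2)h)$, with the convention $\Delta_h^r(f,x)=0$ if $x+rh/2\notin[a,b]$ or $x-rh/2\notin[a,b]$. Let $\varphi(x)=\sqrt{(x-a)(b-x)}$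 and $\omega_\varphi^r(f,t)_2=\sup_{0<h\le t}\|x\mapsto\Delta^r_{h\varphi(x)}(f,x)\|_{L^2([a,b])}$. With $r=[\alpha]+1$ ($[\alpha]$ the integer part of $\alpha$), $$\tilde{\mathcal{C}}(\alpha,C)=\{f\in\mathbb{H}:\|f\|_{\mathbb{H}}\le C\text{ and }\omega_\varphi^r(f,t)_2\le Ct^\alpha\text{ for all }t>0\}.$$ *)

(* Defs.v *)
From HB Require Import structures.
From mathcomp Require Import all_boot all_order all_algebra.
From mathcomp Require Import all_classical all_reals all_analysis.
From mathcomp Require Import measurable_realfun.

Set Implicit Arguments.
Unset Strict Implicit.
Unset Printing Implicit Defensive.

Import Order.TTheory GRing.Theory Num.Theory.
Import numFieldNormedType.Exports.

Local Open Scope classical_set_scope.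
Local Open Scope ring_scope.

Section L2_interval.
Context {R : realType}.
Implicit Types a b : R.

Lemma lebesgue_itvcc_lty a b :
  ((@lebesgue_measure R) `[a, b]%classic < +oo)%E.
Proof. by rewrite lebesgue_measure_itv/= lte_fin; case: ifP => // _; rewrite -EFinD ltry. Qed.

Definition leb a b : {finite_measure set (measurableTypeR R) -> \bar R} :=
  @mfrestr _ (measurableTypeR R) R _ lebesgue_measure
    (measurable_itv `[a, b]) (lebesgue_itvcc_lty a b).

(* The space of a.e. classes; a class coerces to one of its representatives. *)
Definition L2 a b : Type := LspaceType2 (leb a b).

Definition L2_fun a b (f : L2 a b) : measurableTypeR R -> R :=
  f : {mfun_ leb a b, measurableTypeR R >-> measurableTypeR R}.

Coercion L2_fun : L2 >-> Funclass.

Lemma measurable_L2_fun a b (f : L2 a b) : measurable_fun setT (L2_fun f).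
Proof. by move=> mD Y mY; exact: (measurable_funPT (repr (LebesgueSpace.sort f))). Qed.

Definition L2norm a b (f : R -> R) : \bar R := ('N[leb a b]_2%:E[EFin \o f])%E.

Definition L2dist a b (f g : L2 a b) : \bar R := L2norm a b (f \- g).

Definition L2open a b (U : set (L2 a b)) : Prop :=
  forall f, U f -> exists2 e : R, 0 < e &
    forall g, (L2dist f g < e%:E)%E -> U g.

Definition Borel_to_L2 a b d (T : measurableType d) (F : T -> L2 a b) : Prop :=
  forall B, <<s @L2open a b >> B -> measurable (F @^-1` B).

End L2_interval.

Section mixture.
Context {R : realType}.
Implicit Types a b : R.

Record H1 a b := MkH1 {
  H1_fun :> L2 a b;
  H1_ge0 : {ae leb a b, forall t, 0 <= H1_fun t};
  H1_int1 : (\int[leb a b]_t (H1_fun t)%:E = 1)%E }.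

(* [exponential_pdf t] vanishes on the negative half-line, so the mixture is
   viewed as a density on the whole real line. *)
Definition mixture_pdf a b (f : H1 a b) (x : R) : \bar R :=
  (\int[leb a b]_t (f t * exponential_pdf t x)%:E)%E.

Definition mixture_law a b (a0 : 0 < a) (f : H1 a b)
    (A : set (measurableTypeR R)) : \bar R :=
  (\int[lebesgue_measure]_(x in A) mixture_pdf f x)%E.

Section probability.
Variables (a b : R) (a0 : 0 < a) (f : H1 a b).

Let F (z : measurableTypeR R * measurableTypeR R) : \bar R :=
  `|f z.1 * exponential_pdf z.1 z.2|%:E.

Let F_ge0 z : (0 <= F z)%E. Proof. by rewrite lee_fin. Qed.

Let mf : measurable_fun [set: measurableTypeR R] (f : measurableTypeR R -> R).
Proof. exact: measurable_L2_fun. Qed.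

Let mexp : measurable_fun [set: measurableTypeR R * measurableTypeR R]
  (fun z => exponential_pdf z.1 z.2 : R).
Proof.
rewrite /exponential_pdf.
rewrite (_ : (fun _ => _) = (fun z : measurableTypeR R * measurableTypeR R =>
   z.1 * expR (- z.1 * z.2) * \1_`[0, +oo[%classic z.2)); last first.
  by apply/funext => z; rewrite patchE indicE; case: ifPn; rewrite ?mulr1 ?mulr0.
apply: measurable_funM.
  apply: measurable_funM; first exact: measurable_fst.
  apply: measurableT_comp => //; apply: measurable_funM; last exact: measurable_snd.
  by apply: measurableT_comp => //; exact: measurable_fst.
by apply: measurableT_comp; [exact: measurable_indic|exact: measurable_snd].
Qed.

Let mF : measurable_fun setT F.
Proof.
apply/measurable_EFinP; apply: measurableT_comp => //.
apply: measurable_funM => //.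
by apply: measurableT_comp => //; exact: measurable_fst.
Qed.

Let ae_ab : {ae leb a b, forall t, a <= t}.
Proof.
exists (~` `[a, b]%classic); split.
- exact: measurableC.
- by rewrite /leb/= /mfrestr /mrestr setICl measure0.
- by move=> t/=; apply: contra_not; rewrite in_itv/= => /andP[].
Qed.

Let ae_ab_ge0 (P : R -> Prop) : (forall t, a <= t -> 0 <= f t -> P t) ->
  {ae leb a b, forall t, P t}.
Proof.
move=> abP; have fltr := ae_filter_ringOfSetsType (leb a b).
apply: (@filterS2 _ _ fltr _ _ _ _ ae_ab (H1_ge0 f)); exact: abP.
Qed.

Let pdfE x : mixture_pdf f x = fubini_G (leb a b) F x.
Proof.
rewrite /mixture_pdf /fubini_G; apply: ae_eq_integral => //.
- apply/measurable_EFinP; apply: measurable_funM => //.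
  exact: (measurableT_comp mexp (pair2_measurable _)).
- exact: (measurableT_comp mF (pair2_measurable _)).
- apply: ae_ab_ge0 => t at_ ft _.
  rewrite /F/= ger0_norm// mulr_ge0// exponential_pdf_ge0//.
  exact: le_trans (ltW a0) at_.
Qed.

Let pdf_ge0 x : (0 <= mixture_pdf f x)%E.
Proof. by rewrite pdfE; exact: integral_ge0. Qed.

Let mpdf : measurable_fun [set: measurableTypeR R] (mixture_pdf f).
Proof. by rewrite (funext pdfE); exact: measurable_fun_fubini_tonelli_G. Qed.

Let law0 : mixture_law a0 f set0 = 0%E.
Proof. by rewrite /mixture_law integral_set0. Qed.

Let law_ge0 A : (0 <= mixture_law a0 f A)%E.
Proof. exact: integral_ge0. Qed.

Let law_sigma_additive : semi_sigma_additive (mixture_law a0 f).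
Proof.
move=> /= A mA tA mUA; rewrite /mixture_law; apply: cvg_toP.
  apply: ereal_nondecreasing_is_cvgn => m n mn.
  by apply: lee_sum_nneg_natr => // k _ _; exact: integral_ge0.
by rewrite ge0_integral_bigcup//=; exact: measurable_funTS.
Qed.

HB.instance Definition _ := isMeasure.Build _ _ _
  (mixture_law a0 f) law0 law_ge0 law_sigma_additive.

Let law_setT : mixture_law a0 f [set: measurableTypeR R] = 1%E.
Proof.
rewrite /mixture_law (funext pdfE) -fubini_tonelli//.
rewrite -(H1_int1 f); apply: ae_eq_integral => //.
- exact: measurable_fun_fubini_tonelli_F.
- exact/measurable_EFinP.
- apply: ae_ab_ge0 => t at_ ft _.
  have t0 : 0 < t := lt_le_trans a0 at_.
  transitivity (\int[@lebesgue_measure R]_x ((f t)%:E * (exponential_pdf t x)%:E))%E.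
    apply: eq_integral => x _; rewrite -EFinM /F/= ger0_norm//.
    by rewrite mulr_ge0// exponential_pdf_ge0// ltW.
  rewrite ge0_integralZl//.
  + by rewrite integral_exponential_pdf// mule1.
  + apply/measurable_EFinP; exact: measurable_exponential_pdf.
  + by move=> x _; rewrite lee_fin exponential_pdf_ge0// ltW.
Qed.

HB.instance Definition _ :=
  @Measure_isProbability.Build _ _ R (mixture_law a0 f) law_setT.

End probability.
End mixture.

Section iid.
Context d (T : measurableType d) (R : realType).

Definition tuple_cons n (z : T * n.-tuple T) : n.+1.-tuple T :=
  [the n.+1.-tuple T of z.1 :: z.2].

Lemma measurable_tuple_cons n : measurable_fun [set: T * n.-tuple T] (@tuple_cons n).
Proof. by apply: measurable_cons; [exact: measurable_fst|exact: measurable_snd]. Qed.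

HB.instance Definition _ n :=
  isMeasurableFun.Build _ _ _ _ (@tuple_cons n) (@measurable_tuple_cons n).

(* Joint law of [n] i.i.d. observations with law [P]. *)
Fixpoint iid_law (P : probability T R) n : probability (n.-tuple T) R :=
  match n with
  | 0 => dirac [tuple]
  | m.+1 => distribution (P \x iid_law P m)%E (@tuple_cons m)
  end.

End iid.

Lemma iid_lawE d (T : measurableType d) (R : realType) (P : probability T R)
    n (A : 'I_n -> set T) : (forall i, measurable (A i)) ->
  iid_law P n [set x | forall i, A i (tnth x i)] = (\prod_(i < n) P (A i))%E.
Proof.
elim: n A => [|n IH] A mA.
  by rewrite big_ord0/= diracE mem_set// => -[].
rewrite big_ord_recl/= /distribution/= /pushforward/=.
rewrite -IH//.
pose B := [set x : n.-tuple T | forall i, A (lift ord0 i) (tnth x i)].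
have mB : measurable B.
  rewrite (_ : B = \bigcap_(i in [set: 'I_n])
      ((fun x : n.-tuple T => tnth x i) @^-1` A (lift ord0 i))).
    apply: fin_bigcap_measurable => [|i _]; first exact: finite_finset.
    by rewrite -[X in measurable X]setTI; exact: measurable_tnth.
  by apply/seteqP; split => x /= Bx i; [move=> _|]; exact: Bx.
transitivity ((P \x iid_law P n)%E (A ord0 `*` B)).
  congr product_measure1; apply/seteqP; split => -[x y]/=.
    move=> xy; split; first exact: (xy ord0).
    by move=> i; have := xy (lift ord0 i); rewrite tnthS.
  move=> [x0 yi] i; case: (unliftP ord0 i) => [j ->|->//].
  by rewrite tnthS; exact: yi.
exact: product_measure1E.
Qed.

Section smoothness.
Context {R : realType}.
Implicit Types (a b h t alpha C : R) (r : nat) (f : R -> R).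

(* Symmetric difference of order [r] and step [h], cut off to 0 as soon as its
   stencil leaves the interval from [a] to [b]. *)
Definition sdiff a b r h f (x : R) : R :=
  if (x + r%:R * h / 2 \in `[a, b]) && (x - r%:R * h / 2 \in `[a, b]) then
    \sum_(i < r.+1) 'C(r, i)%:R * (-1) ^+ i * f (x + (i%:R - r%:R / 2) * h)
  else 0.

Definition phi a b (x : R) : R := Num.sqrt ((x - a) * (b - x)).

Definition modulus a b r f t : \bar R :=
  ereal_sup [set L2norm a b (fun x => sdiff a b r (h * phi a b x) f x)
            | h in [set h | 0 < h <= t]].

(* The value does not depend on the representative of [f]: for fixed [c], the map
   [x |-> x + c * phi x] has null preimages of null sets in the
   interval from [a] to [b]. *)
Definition smooth_ball a b alpha C : set (L2 a b) :=
  [set f | (L2norm a b f <= C%:E)%E /\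
    forall t, 0 < t ->
      (modulus a b (Num.truncn alpha).+1 f t <= (C * t `^ alpha)%:E)%E].

End smoothness.

Section minimax.
Context {R : realType}.
Variables (a b : R) (a0 : 0 < a).

Definition risk n (fhat : n.-tuple (measurableTypeR R) -> L2 a b) (f : H1 a b)
    : \bar R :=
  (\int[iid_law (mixture_law a0 f) n]_x (L2dist (fhat x) f) ^+ 2)%E.

Definition minimax_risk (alpha C : R) (n : nat) : \bar R :=
  ereal_inf [set ereal_sup [set risk fhat f
                           | f in [set f : H1 a b | smooth_ball alpha C f]]
            | fhat in [set fhat : n.-tuple (measurableTypeR R) -> L2 a b
                      | Borel_to_L2 fhat]].

End minimax.

(* Main.v *)
(** Le Cam's two-point method. One hypothesis is the uniform density on the
   interval, the other adds [delta M^-alpha g], where [g] is a combination of [M]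
   smooth bumps with disjoint supports of width of order [1/M]. Disjointness
   bounds the weighted modulus of [g] by that of a single bump, so the perturbation
   stays in the smoothness ball while its L2 norm is of order [M^-alpha]. By a
   dimension count the coefficients can be chosen so that [g] is orthogonal to the
   polynomials of degree at most [M - 2]; since [t exp(-tx)] is exponentially well
   approximated by such polynomials for [x] up to a multiple of [M], and decays
   exponentially beyond, the two mixtures are at distance [exp(-cM)] in total
   variation. Total variation distances at most add up over the observations, so
   [M] of order [log n] makes the two joint laws indistinguishable. *)
Require Import Defs.
From HB Require Import structures.
From mathcomp Require Import all_boot all_order all_algebra.
From mathcomp Require Import all_classical all_reals all_analysis.
From mathcomp Require Import measurable_realfun.
From mathcomp Require Import ring lra zify.
Import Order.TTheory GRing.Theory Num.Theory.
Import numFieldNormedType.Exports.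
Set Implicit Arguments.
Unset Strict Implicit.
Unset Printing Implicit Defensive.
Local Open Scope classical_set_scope.
Local Open Scope ring_scope.

(** * Symmetric differences of bumps *)

(** The dimension count fixes the coefficients only up to scale. Their squares are normalized to sum
    to [M], but nothing keeps them from concentrating on a few bumps: the sup norm of [g] is bounded
    only by [sqrt M], and [alpha > 1] is what keeps the perturbation below the uniform density. The
    other estimates are therefore made in mean square: the pointwise bound on a difference of [g]
    records which cells its stencil meets, so that integration costs one cell width per bump and
    yields the sum of the squared coefficients.

    The obstacle in that integration is the step [h * phi x], which varies with [x]: the preimage of
    a cell under [x + c * phi x] must have measure of the order of the cell width, although the
    slope of [phi] is unbounded at the endpoints. The cut-off removes the dangerous points: where
    the stencil stays in the interval, [c * phi] has slope at most 1/2. The same estimate lets null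
    sets be ignored when a class is replaced by an explicit function.

    The strict inequality on [C] puts the uniform density, of norm [(b - a)^(-1/2)], inside the norm
    ball with room for the perturbation. *)

Section differences.
Context {R : realType}.

Lemma size_sub_shift (p : {poly R}) n :
  (size p <= n.+1)%N -> (size (p - (p \Po ('X + 1%:P)))%R <= n)%N.
Proof.
move=> pn; case: (eqVneq p 0) => [->|p0]; first by rewrite comp_poly0 subr0 size_poly0.
have sX : size ('X + 1%:P : {poly R}) = 2 by rewrite size_XaddC.
apply/leq_sizeP => j nj; rewrite coefB.
case: (ltnP j (size p).-1) => [jp|pj].
  by exfalso; lia.
case: (leqP (size p) j) => [spj|jsp].
  by rewrite !nth_default ?subr0// size_comp_poly2.
have -> : j = (size p).-1 by apply/eqP; rewrite eqn_leq pj andbT -ltnS prednK// size_poly_gt0.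
have := lead_coef_comp p (_ : (1 < size ('X + 1%:P : {poly R})%R)%N).
rewrite sX lead_coefDl ?size_polyX ?size_polyC ?oner_eq0// lead_coefX expr1n mulr1 => /(_ isT).
by rewrite /lead_coef size_comp_poly2// => ->; rewrite subrr.
Qed.

(** By Pascal's rule the sum of order [n.+1] for [p] is the sum of order [n] for
    [p - (p \Po ('X + 1%:P))], whose top coefficient cancels; order and degree bound thus decrease
    together. *)
Lemma alternating_sum_poly n (p : {poly R}) : (size p <= n)%N ->
  \sum_(i < n.+1) 'C(n, i)%:R * (-1) ^+ i * p.[i%:R] = 0.
Proof.
elim: n p => [|n IH] p.
  by rewrite leqn0 size_poly_eq0 => /eqP ->; rewrite big_ord1 horner0 mulr0.
move=> /size_sub_shift /IH {}IH.
rewrite -[RHS]IH big_ord_recl/= bin0.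
under eq_bigr do rewrite /bump/= add1n binS natrD !mulrDl.
rewrite big_split/= addrA.
rewrite [X in X + _ + _](_ : _ = 'C(n, 0)%:R * (-1) ^+ 0 * p.[0%:R]); last by rewrite bin0.
under [X in _ = X]eq_bigr do
  rewrite hornerD hornerN horner_comp hornerD hornerX hornerC mulrBr natr1.
rewrite big_split/=; congr (_ + _).
  rewrite big_ord_recr/= (bin_small (ltnSn n)) 2!mul0r addr0.
  by rewrite [RHS]big_ord_recl.
by apply: eq_bigr => i _; rewrite exprS; ring.
Qed.

(** The sum inside [sdiff] without its cut-off; in this form it commutes with translations and
    dilations of the argument. *)
Definition fdiff r (h : R) (f : R -> R) (x : R) : R :=
  \sum_(i < r.+1) 'C(r, i)%:R * (-1) ^+ i * f (x + (i%:R - r%:R / 2) * h).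

Lemma fdiffD r h f g x :
  fdiff r h (fun y => f y + g y) x = fdiff r h f x + fdiff r h g x.
Proof. by rewrite /fdiff -big_split; apply: eq_bigr => i _; rewrite /= mulrDr. Qed.

Lemma fdiff_poly r h x (p : {poly R}) : (size p <= r)%N ->
  fdiff r h (fun y => p.[y]) x = 0.
Proof.
(* The affine substitution sends [i] to the [i]-th point of the stencil. *)
move=> pr; pose q := p \Po (h *: 'X + (x - r%:R / 2 * h)%:P).
rewrite /fdiff -[RHS](@alternating_sum_poly r q).
  apply: eq_bigr => i _; congr (_ * _).
  rewrite /q horner_comp; congr (_.[_]); rewrite hornerD hornerZ hornerX hornerC; ring.
have [p0|p0] := eqVneq p 0; first by rewrite /q p0 comp_poly0 size_poly0.
apply: leq_trans (size_comp_poly_leq _ _) _.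
have : (size (h *: 'X + (x - r%:R / 2 * h)%:P)%R <= 2)%N.
  apply: leq_trans (size_polyD _ _) _; rewrite geq_max.
  rewrite (leq_trans (size_polyC_leq1 _))// andbT.
  by apply: leq_trans (size_scale_leq _ _) _; rewrite size_polyX.
by have := p0; rewrite -size_poly_gt0; nia.
Qed.

Lemma fdiff_le r h f x (B : R) : (forall i : 'I_r.+1,
    `|f (x + (i%:R - r%:R / 2) * h)| <= B) -> `|fdiff r h f x| <= 2 ^+ r * B.
Proof.
move=> fB; rewrite /fdiff (le_trans (ler_norm_sum _ _ _))//.
have -> : 2 ^+ r * B = \sum_(i < r.+1) 'C(r, i)%:R * B.
  rewrite -mulr_suml -natr_sum; congr (_ * _).
  have := expnDn 1 1 r; rewrite addn1 => h2.
  rewrite -natrX h2; congr (_%:R); apply: eq_bigr => i _.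
  by rewrite !exp1n !muln1.
apply: ler_sum => i _; rewrite !normrM normr_nat normrX normrN1 expr1n mulr1.
by rewrite ler_wpM2l.
Qed.

Lemma horner_le (p : {poly R}) x : `|x| <= 1 ->
  `|p.[x]| <= \sum_(i < size p) `|p`_i|.
Proof.
move=> x1; rewrite horner_coef (le_trans (ler_norm_sum _ _ _))//.
apply: ler_sum => i _; rewrite normrM normrX ler_piMr//.
by rewrite exprn_ile1.
Qed.

(** Every term of order at least [r] in the Taylor expansion at [x] contains [(y - x) ^+ r]; the
    remaining powers are bounded through [B]. The constant is uniform in [x] because the Taylor
    coefficients on the unit ball are bounded by sums of absolute values of coefficients. *)
Lemma taylor_approx (q : {poly R}) r (B : R) : exists2 L : R, 0 <= L &
  forall x : R, `|x| <= 1 -> exists2 p : {poly R}, (size p <= r)%N &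
    forall y : R, `|y - x| <= B -> `|q.[y] - p.[y]| <= L * `|y - x| ^+ r.
Proof.
pose S i := \sum_(k < size (q^`N(i))) `|(q^`N(i))`_k|.
have S0 i : 0 <= S i by apply: sumr_ge0.
exists (\sum_(i < size q) S (r + i)%N * `|B| ^+ i).
  by apply: sumr_ge0 => i _; rewrite mulr_ge0// exprn_ge0.
move=> x x1; exists (\sum_(i < r) (q^`N(i).[x]) *: ('X - x%:P) ^+ i).
  apply: (leq_trans (size_sum _ _ _)); apply/bigmax_leqP => i _.
  by apply: leq_trans (size_scale_leq _ _) _; rewrite size_exp_XsubC.
move=> y yB; rewrite {1}(_ : y = x + (y - x)); last by ring.
rewrite (@nderiv_taylor_wide _ (r + size q))//; [|exact: mulrC|exact: leq_addl].
have -> : (\sum_(i < r) (q^`N(i).[x]) *: ('X - x%:P) ^+ i).[y] =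
    \sum_(i < r) q^`N(i).[x] * (y - x) ^+ i.
  rewrite horner_sum; apply: eq_bigr => i _.
  by rewrite hornerZ horner_exp hornerXsubC.
rewrite big_split_ord/=.
rewrite addrAC subrr add0r (le_trans (ler_norm_sum _ _ _))// mulr_suml.
apply: ler_sum => i _; rewrite normrM normrX exprD mulrCA mulrC.
rewrite ler_wpM2r ?exprn_ge0// ler_pM ?exprn_ge0//; first exact: horner_le.
by rewrite lerXn2r ?nnegrE//; apply: le_trans yB (ler_norm _).
Qed.

(** Vanishing to order [r] at both ends of the support makes the extension by 0 regular enough for
    differences of order [r]. The support is half-open so that integer translates tile the line. *)
Definition bump r (u : R) : R :=
  if (0 < u) && (u <= 1) then u ^+ r * (1 - u) ^+ r else 0.

Lemma bump_ge0 r u : 0 <= bump r u.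
Proof.
rewrite /bump; case: ifP => // /andP[u0 u1].
by rewrite mulr_ge0// exprn_ge0// ?subr_ge0// ltW.
Qed.

Lemma bump_le1 r u : bump r u <= 1.
Proof.
rewrite /bump; case: ifP => // /andP[u0 u1].
by rewrite mulr_ile1 ?exprn_ge0 ?exprn_ile1//; lra.
Qed.

(** Replaces a bound on derivatives of order [r]. For [x] in the support, [p] is the Taylor
    polynomial of ['X ^+ r * (1 - 'X) ^+ r]; for [x] outside, [p] is 0, since the bump at [y] is
    then at most the [r]-th power of the distance from [y] to the endpoint lying between them. *)
Lemma bump_approx r : exists2 L : R, 0 <= L &
  forall x : R, exists2 p : {poly R}, (size p <= r)%N &
    forall y : R, `|y - x| <= r%:R -> `|bump r y - p.[y]| <= L * `|y - x| ^+ r.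
Proof.
pose q : {poly R} := 'X ^+ r * (1 - 'X) ^+ r.
have qE y : q.[y] = y ^+ r * (1 - y) ^+ r by rewrite /q !hornerE.
have [L L0 qL] := taylor_approx q r r%:R.
pose B : R := (1 + r%:R) ^+ r.
have B0 : 1 <= B by rewrite exprn_ege1// lerDl.
exists (L + B); first by rewrite addr_ge0// (le_trans ler01).
move=> x; have [/andP[x0 x1]|xI] := boolP ((0 < x) && (x <= 1)).
  have [|p pr pL] := qL x; first by rewrite ger0_norm// ltW.
  exists p => // y yx; rewrite mulrDl /bump; case: ifPn => [_|yI].
    rewrite -qE (le_trans (pL _ yx))// lerDl mulr_ge0 ?exprn_ge0//.
  rewrite sub0r normrN; have -> : p.[y] = q.[y] - (q.[y] - p.[y]) by ring.
  rewrite (le_trans (ler_normB _ _))// addrC lerD//; first exact: pL.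
  (* An endpoint of the support separates [x] from [y], so one of the two factors is at most the
     distance from [x] to [y]; the other is at most [1 + r%:R]. *)
  suff yI1 : `|y| * `|1 - y| <= (1 + r%:R) * `|y - x|.
    by rewrite qE normrM !normrX /B -!exprMn lerXn2r// nnegrE mulr_ge0// addr_ge0.
  move: yI; rewrite negb_and -leNgt -ltNge => /orP[y0|y1].
    rewrite mulrC ler_pM//; last by rewrite !ler0_norm; lra.
    by move: yx; rewrite ler0_norm ?ger0_norm; lra.
  rewrite ler_pM//; last by rewrite ler0_norm ?ger0_norm; lra.
  by move: yx; rewrite !ger0_norm; lra.
exists 0; first by rewrite size_poly0.
move=> y yx; rewrite horner0 subr0 /bump; case: ifPn => [/andP[y0 y1]|_]; last first.
  by rewrite normr0 mulr_ge0 ?exprn_ge0//; lra.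
apply: (@le_trans _ _ (1 * `|y - x| ^+ r)); last first.
  by rewrite ler_wpM2r ?exprn_ge0//; lra.
have y1r : 0 <= (1 - y) ^+ r <= 1 by rewrite exprn_ge0 ?exprn_ile1//; lra.
have yr : 0 <= y ^+ r <= 1 by rewrite exprn_ge0 ?exprn_ile1//; lra.
rewrite mul1r ger0_norm ?mulr_ge0//; [|by case/andP: yr|by case/andP: y1r].
move: xI; rewrite negb_and -leNgt -ltNge => /orP[x0|x1].
  apply: (@le_trans _ _ (y ^+ r)); first by nra.
  by rewrite lerXn2r ?nnegrE//; [lra|rewrite ger0_norm; lra].
apply: (@le_trans _ _ ((1 - y) ^+ r)); first by nra.
by rewrite lerXn2r ?nnegrE//; [lra|rewrite ler0_norm; lra].
Qed.

(** For [h <= 1] the local polynomial is annihilated by the difference, and the error, of order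
    [h ^+ r], is at most of order [h] to the power [alpha]. For [h > 1] boundedness of the bump
    suffices. *)
Lemma fdiff_bump r (alpha : R) : 0 < alpha <= r%:R -> exists2 L : R, 0 < L &
  forall x h : R, 0 <= h -> `|fdiff r h (bump r) x| <= L * h `^ alpha.
Proof.
move=> /andP[alpha0 alphar]; have [L L0 approx] := bump_approx r.
pose K : R := 2 ^+ r * (L * r%:R ^+ r).
have K0 : 0 <= K by rewrite !mulr_ge0 ?exprn_ge0.
exists (2 ^+ r + K); first by rewrite ltr_wpDr// exprn_gt0.
move=> x h h0; have [h1|h1] := leP h 1; last first.
  apply: (@le_trans _ _ (2 ^+ r * 1)).
    by apply: fdiff_le => i; rewrite ger0_norm ?bump_ge0// bump_le1.
  rewrite ler_pM ?exprn_ge0//; first by rewrite lerDl.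
  by rewrite -(powRr0 h) ler_powR// ltW//.
have [p pr pL] := approx x.
have -> : fdiff r h (bump r) x = fdiff r h (fun y => bump r y - p.[y]) x.
  rewrite (_ : bump r = fun y => (bump r y - p.[y]) + p.[y]); last first.
    by apply/funext => y; rewrite subrK.
  rewrite fdiffD fdiff_poly// addr0; congr fdiff.
  by apply/funext => y /=; rewrite subrK.
apply: (@le_trans _ _ (K * h `^ alpha)); last first.
  by rewrite ler_wpM2r ?powR_ge0// lerDr exprn_ge0.
apply: (@le_trans _ _ (K * h ^+ r)); last first.
  rewrite ler_wpM2l//; have [->|hN0] := eqVneq h 0.
    have r0 : r != 0%N.
      by apply/eqP => r0; move: alphar; rewrite r0 leNgt alpha0.
    by rewrite expr0n (negbTE r0) powR_ge0.
  rewrite -powR_mulrn// ger_powR//.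
  by rewrite h1 andbT lt_neqAle eq_sym hN0.
rewrite /K -mulrA fdiff_le// => i.
have iB : `|(i%:R - r%:R / 2) * h| <= r%:R * h :> R.
  rewrite normrM (ger0_norm h0) ler_wpM2r// ler_norml.
  have : i%:R <= r%:R :> R by rewrite ler_nat -ltnS.
  by have : 0 <= i%:R :> R by []; lra.
have dE : x + (i%:R - r%:R / 2) * h - x = (i%:R - r%:R / 2) * h by ring.
have := pL (x + (i%:R - r%:R / 2) * h); rewrite dE => /(_ _)/le_trans; apply.
  by rewrite (le_trans iB)// ler_piMr.
by rewrite -mulrA -exprMn ler_wpM2l// lerXn2r// nnegrE mulr_ge0.
Qed.

End differences.

(** * The change of variables behind the weighted modulus *)

Section dominated_measure.
Context {R : realType}.

(* The Lebesgue measure is an outer measure built from half-open intervals. *)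
Lemma lebesgue_dominates (mu : {measure set (measurableTypeR R) -> \bar R}) (K : R) :
  0 < K ->
  (forall u v : R, u < v -> (mu `]u, v]%classic <= (K * (v - u))%:E)%E) ->
  forall A, measurable A -> (mu A <= K%:E * lebesgue_measure A)%E.
Proof.
move=> K0 muK A mA; rewrite -lee_pdivrMl//.
apply: le_ereal_inf_tmp => _ [F [/= oF AF] <-].
have mF k : measurable (F k : set (measurableTypeR R)) by exact: sub_sigma_algebra.
rewrite lee_pdivrMl// -nneseriesZl; last by move=> k _; exact: measure_ge0.
have h := @measure_sigma_subadditive _ _ _ mu A F mF mA AF; apply: (le_trans h).
apply: lee_nneseries => // k _.
case/ocitvP: (oF k) => [->|[[u v] /= uv ->]]; first by rewrite !measure0 mule0.
rewrite wlength_itv_bnd; last exact: ltW.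
by rewrite -EFinM; exact: muK.
Qed.

End dominated_measure.

Section shifted_stencil.
Context {R : realType}.
Variables a b : R.
Implicit Types (x y c m : R).

Lemma phi_ge0 x : 0 <= phi a b x. Proof. exact: sqrtr_ge0. Qed.

Lemma phi_sqr x : a <= x <= b -> phi a b x ^+ 2 = (x - a) * (b - x).
Proof. by move=> /andP[ax xb]; rewrite sqr_sqrtr// mulr_ge0 ?subr_ge0. Qed.

Lemma phi_gt0 x : a < x < b -> 0 < phi a b x.
Proof. by move=> /andP[ax xb]; rewrite sqrtr_gt0 mulr_gt0 ?subr_gt0. Qed.

Lemma phi_le x : a <= x <= b -> phi a b x <= b - a.
Proof.
move=> /[dup] /andP[ax xb] /phi_sqr phiE.
have := phi_ge0 x; nra.
Qed.

(* With [m = r h / 2], the interior points at which the difference of order [r] and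
   step [h * phi x] is not cut off. *)
Definition stencil (m : R) : set R :=
  [set x | a < x < b /\ m * phi a b x <= x - a /\ m * phi a b x <= b - x].

(** The derivative of [phi] is [(a + b - 2 * x) / (2 * phi a b x)], so this says that [m * phi] has
    slope at most 1/2. On the stencil [m * phi] is at most the smaller of [x - a] and [b - x], while
    [a + b - 2 * x] is at most the larger in absolute value, and their product is [phi ^ 2]. *)
Let slope m x : stencil m x -> 0 <= m -> m * `|a + b - 2 * x| <= phi a b x.
Proof.
move=> [/[dup] /phi_gt0 p0 /andP[ax xb] [ma mb]] m0.
have p2 : phi a b x ^+ 2 = (x - a) * (b - x).
  by apply: phi_sqr; rewrite (ltW ax) (ltW xb).
rewrite -(ler_pM2r p0) -expr2 p2; have [h|h] := leP 0 (a + b - 2 * x).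
  by rewrite ger0_norm//; nra.
by rewrite ltr0_norm//; nra.
Qed.

(* [phi x ^ 2 - phi y ^ 2 = (x - y) * (a + b - x - y)], and on the stencil the
   slope of [m * phi] is at most 1/2. *)
Lemma shift_expanding m c x y : `|c| <= m -> stencil m x -> stencil m y ->
  `|x - y| / 2 <= `|(x + c * phi a b x) - (y + c * phi a b y)|.
Proof.
move=> cm Sx Sy; have m0 : 0 <= m by rewrite (le_trans _ cm).
have px := phi_gt0 Sx.1; have py := phi_gt0 Sy.1.
have [/andP[ax xb] _] := Sx; have [/andP[ay yb] _] := Sy.
have x2 : phi a b x ^+ 2 = (x - a) * (b - x).
  by apply: phi_sqr; rewrite (ltW ax) (ltW xb).
have y2 : phi a b y ^+ 2 = (y - a) * (b - y).
  by apply: phi_sqr; rewrite (ltW ay) (ltW yb).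
have sx := slope Sx m0; have sy := slope Sy m0.
suff : `|c * (phi a b x - phi a b y)| <= `|x - y| / 2.
  move=> h; have -> : x + c * phi a b x - (y + c * phi a b y) =
    (x - y) + c * (phi a b x - phi a b y) by ring.
  have := lerB_normD (x - y) (c * (phi a b x - phi a b y)); lra.
have pp : 0 < phi a b x + phi a b y by rewrite addr_gt0.
rewrite -(ler_pM2r pp) -{1}(ger0_norm (ltW pp)) -normrM.
have -> : c * (phi a b x - phi a b y) * (phi a b x + phi a b y) =
    (x - y) * (c * (a + b - x - y)).
  have -> : c * (phi a b x - phi a b y) * (phi a b x + phi a b y) =
    c * (phi a b x ^+ 2 - phi a b y ^+ 2) by ring.
  by rewrite x2 y2; ring.
rewrite normrM -mulrA ler_wpM2l// normrM.
have : `|a + b - x - y| <= (`|a + b - 2 * x| + `|a + b - 2 * y|) / 2.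
  have -> : a + b - x - y = ((a + b - 2 * x) + (a + b - 2 * y)) / 2 by field.
  by rewrite normrM (@ger0_norm _ (2^-1))// ler_wpM2r// ler_normD.
move=> h; apply: (@le_trans _ _ (m * ((`|a + b - 2 * x| + `|a + b - 2 * y|) / 2))).
  by rewrite ler_pM.
by lra.
Qed.

End shifted_stencil.

Section stencil_preimage.
Context {R : realType}.
Variables a b : R.
Implicit Types (x y c m : R).

Lemma measurable_phi : measurable_fun [set: measurableTypeR R] (phi a b).
Proof.
apply: (@measurableT_comp _ _ _ _ _ _ (@Num.sqrt R)).
  by apply: continuous_measurable_fun; exact: sqrt_continuous.
by apply: measurable_funM; apply: measurable_funB.
Qed.

Lemma measurable_shift c :
  measurable_fun [set: measurableTypeR R] (fun x : R => x + c * phi a b x).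
Proof.
apply: measurable_funD => //; apply: measurable_funM => //.
exact: measurable_phi.
Qed.

Lemma measurable_stencil m :
  measurable (stencil a b m : set (measurableTypeR R)).
Proof.
have mle (f g : R -> R) : measurable_fun [set: measurableTypeR R] f ->
    measurable_fun [set: measurableTypeR R] g ->
    measurable ([set x | f x <= g x] : set (measurableTypeR R)).
  by move=> mf mg; rewrite -[X in measurable X]setTI; exact: measurable_fun_le.
rewrite (_ : stencil a b m = `]a, b[%classic `&` ([set x | m * phi a b x <= x - a] `&`
    [set x | m * phi a b x <= b - x])); last first.
  by apply/seteqP; split => x /=; rewrite in_itv/=.
apply: measurableI; first exact: measurable_itv.
by apply: measurableI; apply: mle; try apply: measurable_funM; try apply: measurable_funB;
  try exact: measurable_phi.
Qed.

(** The shift contracts distances by a factor 2 at most, so the preimage of an interval of length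
    [l] lies within [2 * l] of any one of its points, hence in an interval of length [4 * l].
    General sets follow by comparing the pushforward with Lebesgue measure. *)
Lemma stencil_preimage_le m c (A : set (measurableTypeR R)) :
  `|c| <= m -> measurable A ->
  ((@lebesgue_measure R) ((fun x : R => (x + c * phi a b x)%R) @^-1` A `&` stencil a b m)
    <= 4%:E * (@lebesgue_measure R) A)%E.
Proof.
move=> cm mA.
pose T : measurableTypeR R -> measurableTypeR R := fun x => x + c * phi a b x.
have mT : measurable_fun [set: measurableTypeR R] T by exact: measurable_shift.
pose mu' : {measure set (measurableTypeR R) -> \bar R} :=
  pushforward (mrestr (@lebesgue_measure R) (measurable_stencil m)) T.
pose mu := mu' mT.
suff muI : forall u v : R, u < v -> (mu `]u, v]%classic <= (4 * (v - u))%:E)%E.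
  exact: (@lebesgue_dominates R mu 4 (ltr0n _ 4) muI A mA).
move=> u v uv; rewrite /mu /mu'/= /pushforward/= /mrestr.
set B := _ `&` _.
have mB : measurable B.
  apply: measurableI; last exact: measurable_stencil.
  by rewrite -[X in measurable X]setTI; exact: (mT).
have [->|/set0P[x0 [Tx0 Sx0]]] := eqVneq B set0.
  by rewrite measure0 lee_fin mulr_ge0// subr_ge0 ltW.
apply: (@le_trans _ _ ((@lebesgue_measure R)
    `[x0 - 2 * (v - u), x0 + 2 * (v - u)]%classic)).
  apply: le_measure; rewrite ?inE//.
  move=> x [Tx Sx]; rewrite /= in_itv/=.
  have := shift_expanding cm Sx Sx0.
  move: Tx Tx0; rewrite /T /= !in_itv/= => /andP[h1 h2] /andP[h3 h4].
  have : `|x + c * phi a b x - (x0 + c * phi a b x0)| <= v - u.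
    by rewrite ler_norml; lra.
  move=> h5 h6; have : `|x - x0| <= 2 * (v - u) by lra.
  by rewrite ler_norml => ?; lra.
rewrite lebesgue_measure_itv/=; case: ifP => _; rewrite -?EFinD lee_fin; lra.
Qed.

End stencil_preimage.

(** * Two-point lower bound *)

Section tensorization.
Context {R : realType}.
Local Open Scope ereal_scope.

Lemma integral_le_add_cst d (T : measurableType d) (P : probability T R)
    (f g : T -> \bar R) (e : R) :
  (0 <= e)%R -> measurable_fun setT f -> measurable_fun setT g ->
  (forall x, 0 <= f x) -> (forall x, 0 <= g x) ->
  (forall x, f x <= g x + e%:E) ->
  \int[P]_x f x <= \int[P]_x g x + e%:E.
Proof.
move=> e0 mf mg f0 g0 fg.
apply: (@le_trans _ _ (\int[P]_x (g x + e%:E))).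
  apply: ge0_le_integral => //; apply: emeasurable_funD => //.
rewrite ge0_integralD//.
have eE : \int[P]_x e%:E = e%:E.
  have := @integral_cst _ _ _ P setT measurableT e%:E.
  by rewrite -[X in e%:E * X]/(P [set: T]) (probability_setT P) mule1.
by rewrite eE.
Qed.

Lemma product_measure_le_add d1 d2 (T1 : measurableType d1) (T2 : measurableType d2)
    (P Q : probability T1 R) (P' Q' : probability T2 R) (e e' : R) :
  (0 <= e)%R -> (0 <= e')%R ->
  (forall B, measurable B -> P B <= Q B + e%:E) ->
  (forall B, measurable B -> P' B <= Q' B + e'%:E) ->
  forall A, measurable A -> (P \x P') A <= (Q \x Q') A + (e + e')%:E.
Proof.
move=> e0 e'0 PQ PQ' A mA.
(* hybrid between the two products, by exchanging the order of integration *)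
have pE (M : probability T1 R) : (M \x P') A = (M \x^ P') A.
  apply: (@product_measure_unique _ _ _ _ _ M P' (M \x^ P')) => // B C mB mC.
  exact: product_measure2E.
apply: (@le_trans _ _ ((Q \x P') A + e%:E)).
  rewrite !pE /product_measure2; apply: integral_le_add_cst => //=.
  - exact: measurable_fun_ysection.
  - exact: measurable_fun_ysection.
  - by move=> x; apply: PQ; exact: measurable_ysection.
rewrite (addrC e) EFinD addeA; apply: leeD2r.
rewrite /product_measure1; apply: integral_le_add_cst => //=.
- exact: measurable_fun_xsection.
- exact: measurable_fun_xsection.
- by move=> x; apply: PQ'; exact: measurable_xsection.
Qed.

Lemma iid_law_le_add d (T : measurableType d) (P Q : probability T R) (e : R) :
  (0 <= e)%R -> (forall B, measurable B -> P B <= Q B + e%:E) ->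
  forall n A, measurable A -> iid_law P n A <= iid_law Q n A + (n%:R * e)%:E.
Proof.
move=> e0 PQ; elim => [|n IH] A mA /=; first by rewrite mul0r adde0.
rewrite -natr1 mulrDl mul1r (addrC _ e).
apply: (@product_measure_le_add _ _ _ _ P Q (iid_law P n) (iid_law Q n)) => //.
  by rewrite mulr_ge0.
rewrite -[X in measurable X]setTI; exact: measurable_tuple_cons.
Qed.

End tensorization.

Section integrals.
Context d (T : measurableType d) (R : realType).
Variable mu : {measure set T -> \bar R}.
Local Open Scope ereal_scope.

(* No measurability is needed: both sides are suprema over the simple functions
   below the integrand. *)
Lemma ge0_integral_le (f g : T -> \bar R) :
  (forall x, 0 <= f x) -> (forall x, f x <= g x) ->
  \int[mu]_x f x <= \int[mu]_x g x.
Proof.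
move=> f0 fg; rewrite !ge0_integralTE//; last by move=> x; exact: le_trans (fg x).
by apply: ereal_sup_le => _ [h /= hf <-]; exists h => //= x; exact: le_trans (fg x).
Qed.

(** Markov's inequality, in the form that bounds a risk from below by the probability of a test
    error. *)
Lemma measure_le_integral (f : T -> \bar R) (A : set T) (c : R) :
  (0 <= c)%R -> measurable A -> (forall x, 0 <= f x) ->
  (forall x, A x -> c%:E <= f x) -> c%:E * mu A <= \int[mu]_x f x.
Proof.
move=> c0 mA f0 fA.
apply: (@le_trans _ _ (\int[mu]_x (c%:E * (\1_A x)%:E))).
  rewrite ge0_integralZl//; last by apply/measurable_EFinP; exact: measurable_indic.
  by rewrite integral_indic// setIT.
apply: ge0_integral_le => x; first by rewrite mule_ge0 ?lee_fin.
rewrite indicE; case: (boolP (x \in A)) => [/set_mem/fA|_]; first by rewrite mule1.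
by rewrite mule0.
Qed.

End integrals.

Section L2.
Context {R : realType}.
Variables a b : R.
Local Open Scope ereal_scope.

Lemma L2norm_ge0 (f : R -> R) : 0 <= L2norm a b f.
Proof. exact: Lnorm_ge0. Qed.

Lemma sqr_L2norm (f : R -> R) :
  L2norm a b f ^+ 2 = \int[leb a b]_t (f t ^+ 2)%:E.
Proof.
have -> : L2norm a b f ^+ 2 = L2norm a b f `^ 2.
  have := L2norm_ge0 f; case: (L2norm a b f) => [r||]// r0.
    by rewrite poweR_EFin powR_mulrn// expe2 -EFinM expr2.
  by rewrite poweRyr// expeS expe2 mulyy mulyy.
rewrite powR_Lnorm//; apply: eq_integral => t _.
by rewrite /= powR_mulrn// real_normK// num_real.
Qed.

Lemma L2norm_le (f : R -> R) (K : R) : (0 <= K)%R ->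
  \int[leb a b]_t (f t ^+ 2)%:E <= (K ^+ 2)%:E -> L2norm a b f <= K%:E.
Proof.
move=> K0; rewrite -sqr_L2norm; have := L2norm_ge0 f.
case: (L2norm a b f) => [r r0||]//.
by rewrite expe2 -EFinM -expr2 !lee_fin ler_sqr ?nnegrE.
Qed.

Lemma L2norm_ge (f : R -> R) (K : R) : (0 <= K)%R ->
  (K ^+ 2)%:E <= \int[leb a b]_t (f t ^+ 2)%:E -> K%:E <= L2norm a b f.
Proof.
move=> K0; rewrite -sqr_L2norm; have := L2norm_ge0 f.
case: (L2norm a b f) => [r r0||]//; last by move=> _ _; rewrite leey.
by rewrite expe2 -EFinM -expr2 !lee_fin ler_sqr ?nnegrE.
Qed.

Lemma L2dist_ge0 (f g : L2 a b) : 0 <= L2dist f g.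
Proof. exact: L2norm_ge0. Qed.

Lemma L2dist_sym (f g : L2 a b) : L2dist f g = L2dist g f.
Proof.
rewrite /L2dist /L2norm -[RHS]oppe_Lnorm; congr ('N[_]_ _ [_]).
apply/funext => t; apply: (congr1 EFin); rewrite /=; ring.
Qed.

Lemma L2dist_triangle (g f h : L2 a b) : L2dist f h <= L2dist f g + L2dist g h.
Proof.
have -> : L2dist f h = L2norm a b ((f \- g) \+ (g \- h))%R.
  by congr L2norm; apply/funext => t /=; rewrite addrA subrK.
apply: minkowski_EFin; last by rewrite ler1n.
all: apply: measurable_funB; exact: measurable_L2_fun.
Qed.

(** This makes the event that an estimator falls near a hypothesis measurable. *)
Lemma L2open_ball (f0 : L2 a b) (r : R) :
  L2open [set g : L2 a b | L2dist g f0 < r%:E].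
Proof.
move=> f /=; have := L2dist_ge0 f f0; case E : (L2dist f f0) => [s| |]// _ sr.
exists (r - s)%R; first by rewrite subr_gt0 -lte_fin.
move=> g fg /=; apply: (le_lt_trans (L2dist_triangle f g f0)).
by rewrite L2dist_sym E -(subrK s r) EFinD lteD2rE.
Qed.

End L2.

Lemma test_error_ge d (T : measurableType d) (R : realType) (P Q : probability T R)
    (A : set T) (c e : R) : measurable A -> 0 <= c -> (P A <= Q A + e%:E)%E ->
  ((c * (1 - e))%:E <= c%:E * P (~` A) + c%:E * Q A)%E.
Proof.
move=> mA c0; rewrite probability_setC//.
have /fineK <- := fin_num_measure P A mA; have /fineK <- := fin_num_measure Q A mA.
by rewrite -EFinB -!EFinM -!EFinD !lee_fin; nra.
Qed.

Section two_points.
Context {R : realType}.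
Variables (a b : R) (a0 : 0 < a).

(** The estimator is turned into the test that accepts [f0] when it falls within [D / 2] of it.
    Rejecting costs [(D / 2) ^+ 2] under [f0]; accepting costs as much under [f1], by the triangle
    inequality. The two error probabilities sum to at least [1 - n%:R * e]. *)
Lemma two_point_risk n (fhat : n.-tuple (measurableTypeR R) -> L2 a b)
    (f0 f1 : H1 a b) (D e : R) : Borel_to_L2 fhat -> 0 <= D -> 0 <= e ->
  (D%:E <= L2dist f0 f1)%E ->
  (forall B, measurable B -> mixture_law a0 f0 B <= mixture_law a0 f1 B + e%:E)%E ->
  (((D / 2) ^+ 2 * (1 - n%:R * e))%:E <= risk a0 fhat f0 + risk a0 fhat f1)%E.
Proof.
move=> mfhat D0 e0 DE close.
pose A := fhat @^-1` [set g : L2 a b | (L2dist g f0 < (D / 2)%:E)%E].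
have mA : measurable A.
  by apply: mfhat; apply: sub_sigma_algebra; exact: L2open_ball.
have D20 : 0 <= (D / 2) ^+ 2 by rewrite sqr_ge0.
have sqrD (x : \bar R) : ((D / 2)%:E <= x)%E -> (((D / 2) ^+ 2)%:E <= x ^+ 2)%E.
  case: x => [r||]//; last by move=> _; rewrite expe2 mulyy leey.
  by rewrite expe2 -EFinM -expr2 !lee_fin => ?; rewrite ler_sqr// nnegrE; lra.
have r0 : (((D / 2) ^+ 2)%:E * iid_law (mixture_law a0 f0) n (~` A) <= risk a0 fhat f0)%E.
  apply: measure_le_integral => //; first exact: measurableC.
    by move=> x; rewrite expe_ge0// L2dist_ge0.
  by move=> x Ax; apply: sqrD; rewrite leNgt; apply/negP.
have r1 : (((D / 2) ^+ 2)%:E * iid_law (mixture_law a0 f1) n A <= risk a0 fhat f1)%E.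
  apply: measure_le_integral => //.
    by move=> x; rewrite expe_ge0// L2dist_ge0.
  move=> x Ax; apply: sqrD.
  have := le_trans DE (L2dist_triangle (fhat x) f0 f1).
  move: Ax; rewrite /A/= L2dist_sym.
  have := L2dist_ge0 f0 (fhat x); have := L2dist_ge0 (fhat x) f1.
  case: (L2dist f0 (fhat x)) => [u||]//; case: (L2dist (fhat x) f1) => [v||]//.
    by rewrite -EFinD !lee_fin lte_fin; lra.
  by move=> *; rewrite leey.
apply: le_trans (leeD r0 r1).
exact: test_error_ge mA D20 (iid_law_le_add e0 close mA).
Qed.

Lemma minimax_risk_two_points n (alpha C : R) (f0 f1 : H1 a b) (D e : R) :
  0 <= D -> 0 <= e -> smooth_ball alpha C f0 -> smooth_ball alpha C f1 ->
  (D%:E <= L2dist f0 f1)%E ->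
  (forall B, measurable B -> mixture_law a0 f0 B <= mixture_law a0 f1 B + e%:E)%E ->
  n%:R * e <= 1 / 2 ->
  ((D ^+ 2 / 16)%:E <= minimax_risk b a0 alpha C n)%E.
Proof.
move=> D0 e0 Sf0 Sf1 DE close ne.
(* The 16 collects 4 from the squared half-distance, 2 because a supremum is at least half of a sum
   of two risks, and 2 from [1 - n%:R * e >= 1 / 2]. *)
apply: le_ereal_inf_tmp => _ [fhat mfhat <-].
have risk_le (f : H1 a b) : smooth_ball alpha C f -> (risk a0 fhat f <= ereal_sup
    [set risk a0 fhat f | f in [set f : H1 a b | smooth_ball alpha C f]])%E.
  by move=> Sf; apply: ereal_sup_ubound; exists f.
have h0 := risk_le _ Sf0; have h1 := risk_le _ Sf1.
move: h0 h1; set s := ereal_sup _ => h0 h1.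
have := le_trans (two_point_risk mfhat D0 e0 DE close) (leeD h0 h1).
have : (0 <= s)%E.
  by apply: le_trans h0; apply: integral_ge0 => x _; rewrite expe_ge0// L2dist_ge0.
case: s {h0 h1} => [s||]//; last by move=> *; rewrite leey.
rewrite -EFinD !lee_fin => _; have : 0 <= D ^+ 2 by rewrite sqr_ge0.
rewrite expr_div_n; nra.
Qed.

End two_points.

(** * Sums of disjoint bumps *)

Section L2_build.
Context {R : realType}.
Variables a b : R.

Lemma lebE (A : set (measurableTypeR R)) :
  leb a b A = (@lebesgue_measure R) (A `&` `[a, b]%classic).
Proof. by []. Qed.

Lemma leb_le (B : set (measurableTypeR R)) :
  measurable B -> (leb a b B <= (@lebesgue_measure R) B)%E.
Proof. by move=> mB; rewrite lebE; apply: measureIl => //; exact: measurable_itv. Qed.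

Lemma leb_eq0 (B : set (measurableTypeR R)) :
  measurable B -> ((@lebesgue_measure R) B <= 0)%E -> (leb a b B = 0)%E.
Proof.
move=> mB B0; apply/eqP; rewrite eq_le measure_ge0 andbT.
exact: le_trans (leb_le mB) B0.
Qed.

Lemma leb_setT : a < b -> leb a b [set: measurableTypeR R] = (b - a)%:E.
Proof.
by move=> ab; rewrite lebE setTI lebesgue_measure_itv/= lte_fin ab EFinB.
Qed.

Lemma integral_leb_cst (k : R) : a < b ->
  (\int[leb a b]_t k%:E = (k * (b - a))%:E)%E.
Proof.
move=> ab.
have := @integral_cst _ _ _ (leb a b) setT measurableT k%:E.
by move=> ->; rewrite EFinM; congr (_ * _)%E; exact: leb_setT.
Qed.

Lemma ae_leb_itv (P : R -> Prop) : (forall t, a <= t <= b -> P t) ->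
  {ae leb a b, forall t, P t}.
Proof.
move=> abP; exists (~` `[a, b]%classic); split.
- by apply: measurableC; exact: measurable_itv.
- by rewrite lebE setICl measure0.
- by move=> t/=; apply: contra_not; rewrite in_itv/= => /abP.
Qed.

Lemma integral_sqr_ae_eq (f g : R -> R) :
  measurable_fun [set: measurableTypeR R] f ->
  measurable_fun [set: measurableTypeR R] g ->
  {ae leb a b, forall t, f t = g t} ->
  (\int[leb a b]_t (f t ^+ 2)%:E = \int[leb a b]_t (g t ^+ 2)%:E)%E.
Proof.
move=> mf mg fg; apply: ge0_ae_eq_integral => //.
- by apply/measurable_EFinP; exact: measurable_funX.
- by apply/measurable_EFinP; exact: measurable_funX.
- by move=> t _; rewrite lee_fin sqr_ge0.
- by move=> t _; rewrite lee_fin sqr_ge0.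
- have fltr := ae_filter_ringOfSetsType (leb a b).
  by apply: filterS fg => t /= -> _.
Qed.

(** The class of [u] is taken in the quotient of measurable functions and its finite norm is checked
    on the chosen representative. That representative agrees with [u] only almost everywhere, which
    is why everything below is stated up to null sets. *)
Lemma L2_of_bounded (u : R -> R) (K : R) : a < b ->
  measurable_fun [set: measurableTypeR R] (u : measurableTypeR R -> measurableTypeR R) ->
  (forall t, a <= t <= b -> `|u t| <= K) ->
  exists f : L2 a b, {ae leb a b, forall t, f t = u t}.
Proof.
move=> ab mu uK.
pose u' : measurableTypeR R -> measurableTypeR R := u.
have mu' : measurable_fun [set: measurableTypeR R] u' := mu.
pose m := mfun_Sub (mem_set mu' : u' \in mfun).
pose q : {mfun_ leb a b, measurableTypeR R >-> measurableTypeR R} :=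
  (\pi_({mfun_ leb a b, measurableTypeR R >-> measurableTypeR R})%qT m)%qT.
have qm : {ae leb a b, forall t, (q : R -> R) t = u t}.
  have /eqmodP/asboolP := reprK q.
  have fltr := ae_filter_ringOfSetsType (leb a b).
  by apply: filterS => t /(_ I).
have mq : measurable_fun [set: measurableTypeR R] (q : R -> R).
  by move=> mD Y mY; exact: (measurable_funPT (repr q)).
have finq : finite_norm (leb a b) 2%:E (q : R -> R).
  suff : (L2norm a b q <= (`|K| * (1 + (b - a)))%:E)%E.
    by move=> /le_lt_trans; apply; exact: ltry.
  have ba : 0 < b - a by rewrite subr_gt0.
  apply: L2norm_le; first by rewrite mulr_ge0// ltW// addr_gt0.
  rewrite (integral_sqr_ae_eq mq mu qm).
  apply: (@le_trans _ _ (\int[leb a b]_t (K ^+ 2)%:E)%E).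
    have fltr := ae_filter_ringOfSetsType (leb a b).
    apply: ae_ge0_le_integral => //.
    - by move=> t _; rewrite lee_fin sqr_ge0.
    - by apply/measurable_EFinP; exact: measurable_funX.
    - by move=> t _; rewrite lee_fin sqr_ge0.
    - have := @ae_leb_itv (fun t => `|u t| <= K) uK.
      apply: filterS => t utK _; rewrite lee_fin -[leLHS]real_normK ?num_real//.
      by rewrite ler_sqr ?nnegrE// (le_trans _ utK).
  rewrite integral_leb_cst// lee_fin exprMn real_normK ?num_real//.
  by rewrite ler_wpM2l ?sqr_ge0//; nra.
pose f : L2 a b :=
  LebesgueSpace.Pack (LebesgueSpace.Class (isFinLebesgue.Build _ _ _ _ _ _ q finq)).
by exists f.
Qed.

Lemma H1_of_bounded (u : R -> R) (K : R) : a < b ->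
  measurable_fun [set: measurableTypeR R] (u : measurableTypeR R -> measurableTypeR R) ->
  (forall t, a <= t <= b -> 0 <= u t <= K) ->
  (\int[leb a b]_t (u t)%:E = 1)%E ->
  exists f : H1 a b, {ae leb a b, forall t, f t = u t}.
Proof.
move=> ab mu uK u1.
have fltr := ae_filter_ringOfSetsType (leb a b).
have [|f fu] := @L2_of_bounded u K ab mu.
  by move=> t /uK /andP[u0 ?]; rewrite ger0_norm.
have u0 : {ae leb a b, forall t, 0 <= u t}.
  by apply: ae_leb_itv => t /uK /andP[].
have f0 : {ae leb a b, forall t, 0 <= f t}.
  by apply: filterS2 fu u0 => t ->.
have f1 : (\int[leb a b]_t (f t)%:E = 1)%E.
  rewrite -u1; apply: ae_eq_integral => //.
  - by apply/measurable_EFinP; exact: measurable_L2_fun.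
  - exact/measurable_EFinP.
  - by apply: filterS fu => t /= ->.
by exists (MkH1 f0 f1).
Qed.

End L2_build.

Section sums.
Context {R : realType}.

Lemma sqr_sum_orthogonal n (f : 'I_n -> R) :
  (forall j k, j != k -> f j * f k = 0) ->
  (\sum_(j < n) f j) ^+ 2 = \sum_(j < n) f j ^+ 2.
Proof.
move=> f0; rewrite expr2 big_distrlr/=; apply: eq_bigr => j _.
by rewrite (bigD1 j)//= big1 ?addr0// => k kj; rewrite f0// eq_sym.
Qed.

Lemma sqr_sum_le n (f : 'I_n -> R) :
  (\sum_(j < n) f j) ^+ 2 <= n%:R * \sum_(j < n) f j ^+ 2.
Proof.
rewrite expr2 big_distrlr/=.
apply: (@le_trans _ _ (\sum_(i < n) \sum_(j < n) (f i ^+ 2 + f j ^+ 2) / 2)).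
  apply: ler_sum => i _; apply: ler_sum => j _.
  by have := sqr_ge0 (f i - f j); nra.
rewrite (eq_bigr (fun i => (n%:R * f i ^+ 2 + \sum_(j < n) f j ^+ 2) / 2)).
  rewrite -mulr_suml big_split/= -mulr_sumr sumr_const card_ord -[X in _ + X]mulr_natl.
  lra.
move=> i _; rewrite -mulr_suml big_split/= sumr_const card_ord.
by rewrite -[X in X + _]mulr_natl.
Qed.

End sums.

Section bump_sum.
Context {R : realType}.
Variables (r M : nat) (a w : R) (c : 'I_M -> R).
Hypothesis w0 : 0 < w.

Definition in_cell (j : nat) (t : R) : bool :=
  (0 < (t - a) / w - j%:R) && ((t - a) / w - j%:R <= 1).

Definition bump_sum (t : R) : R :=
  \sum_(j < M) c j * bump r ((t - a) / w - j%:R).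

Lemma in_cell_inj (i j : nat) t : in_cell i t -> in_cell j t -> i = j.
Proof.
have lt_cell (k l : nat) : (k < l)%N -> in_cell k t -> ~~ in_cell l t.
  move=> kl /andP[_ h1]; rewrite negb_and -leNgt; apply/orP; left.
  have : (k.+1%:R <= l%:R :> R) by rewrite ler_nat.
  by rewrite -natr1; lra.
case: (ltngtP i j) => // ij hi hj.
  by have := lt_cell _ _ ij hi; rewrite hj.
by have := lt_cell _ _ ij hj; rewrite hi.
Qed.

Lemma bump_notin_cell j t : ~~ in_cell j t -> bump r ((t - a) / w - j%:R) = 0.
Proof. by rewrite /bump /in_cell => /negbTE ->. Qed.

Lemma sqr_bump_sum t :
  bump_sum t ^+ 2 = \sum_(j < M) c j ^+ 2 * bump r ((t - a) / w - j%:R) ^+ 2.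
Proof.
rewrite /bump_sum sqr_sum_orthogonal.
  by apply: eq_bigr => j _; rewrite exprMn.
move=> j k jk; have [hj|/bump_notin_cell ->] := boolP (in_cell j t); last first.
  by rewrite mulr0 mul0r.
have [hk|/bump_notin_cell ->] := boolP (in_cell k t); last by rewrite !mulr0.
by case/eqP: jk; apply: val_inj; exact: in_cell_inj hj hk.
Qed.

Lemma sqr_sum_in_cell t :
  (\sum_(j < M) `|c j| * (in_cell j t)%:R) ^+ 2 =
  \sum_(j < M) c j ^+ 2 * (in_cell j t)%:R.
Proof.
rewrite sqr_sum_orthogonal.
  apply: eq_bigr => j _; rewrite exprMn real_normK ?num_real//.
  by case: in_cell; rewrite ?expr1n ?expr0n.
move=> j k jk; have [hj|] := boolP (in_cell j t); last by rewrite mulr0 mul0r.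
have [hk|] := boolP (in_cell k t); last by rewrite !mulr0.
by case/eqP: jk; apply: val_inj; exact: in_cell_inj hj hk.
Qed.

Lemma bump_sum_le t : bump_sum t ^+ 2 <= \sum_(j < M) c j ^+ 2.
Proof.
rewrite sqr_bump_sum; apply: ler_sum => j _.
by rewrite ler_piMr ?sqr_ge0// exprn_ile1 ?bump_ge0 ?bump_le1.
Qed.

(** A bump contributes only if some stencil point lies in its cell. Squaring uses Cauchy-Schwarz
    over the [r.+1] stencil points and disjointness over the cells, so no factor [M] appears. The
    indicators are kept because the bound is to be integrated in [x]. *)
Lemma fdiff_bump_sum_le (alpha L : R) : 0 <= L ->
  (forall x h : R, 0 <= h -> `|fdiff r h (bump r) x| <= L * h `^ alpha) ->
  forall x h : R, 0 <= h ->
  fdiff r h bump_sum x ^+ 2 <= L ^+ 2 * (h / w) `^ (2 * alpha) * r.+1%:R *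
    \sum_(i < r.+1) \sum_(j < M)
      c j ^+ 2 * (in_cell j (x + (i%:R - r%:R / 2) * h))%:R.
Proof.
move=> L0 fL x h h0.
have hw0 : 0 <= h / w by rewrite divr_ge0// ltW.
pose y i : R := x + (i%:R - r%:R / 2) * h.
have fE : fdiff r h bump_sum x =
    \sum_(j < M) c j * fdiff r (h / w) (bump r) ((x - a) / w - j%:R).
  rewrite /fdiff /bump_sum.
  under eq_bigr do rewrite mulr_sumr.
  rewrite exchange_big/=; apply: eq_bigr => j _.
  rewrite mulr_sumr; apply: eq_bigr => i _.
  rewrite mulrCA; congr (_ * (_ * bump r _)).
  by field; rewrite gt_eqF.
have fj (j : 'I_M) : `|fdiff r (h / w) (bump r) ((x - a) / w - j%:R)| <=
    L * (h / w) `^ alpha * \sum_(i < r.+1) (in_cell j (y i))%:R.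
  have K0 : 0 <= L * (h / w) `^ alpha by rewrite mulr_ge0 ?powR_ge0.
  have [/existsP[i hi]|/existsPn hN] := boolP [exists i : 'I_r.+1, in_cell j (y i)].
    apply: (le_trans (fL _ _ hw0)); rewrite ler_peMr//.
    by rewrite (bigD1 i)//= hi lerDl sumr_ge0.
  rewrite /fdiff big1 => [|i _]; first by rewrite normr0 (mulr_ge0 K0)// sumr_ge0.
  have -> : (x - a) / w - j%:R + (i%:R - r%:R / 2) * (h / w) = (y i - a) / w - j%:R.
    by rewrite /y; field; rewrite gt_eqF.
  by rewrite bump_notin_cell ?mulr0.
have fG : `|fdiff r h bump_sum x| <= L * (h / w) `^ alpha *
    \sum_(i < r.+1) \sum_(j < M) `|c j| * (in_cell j (y i))%:R.
  rewrite fE (le_trans (ler_norm_sum _ _ _))// exchange_big mulr_sumr.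
  apply: ler_sum => j _; rewrite normrM -mulr_sumr mulrCA.
  by rewrite ler_wpM2l.
rewrite -[leLHS]real_normK ?num_real//.
apply: (@le_trans _ _ ((L * (h / w) `^ alpha *
    \sum_(i < r.+1) \sum_(j < M) `|c j| * (in_cell j (y i))%:R) ^+ 2)).
  by rewrite ler_sqr ?nnegrE// (le_trans _ fG).
have hE : (h / w) `^ (2 * alpha) = ((h / w) `^ alpha) ^+ 2.
  by rewrite -powR_mulrn ?powR_ge0// -powRrM (mulrC alpha).
rewrite hE; set B := _ `^ alpha; set X := \sum_(i < r.+1) _; set Y := \sum_(i < r.+1) _.
have -> : (L * B * X) ^+ 2 = (L * B) ^+ 2 * X ^+ 2 by ring.
have -> : L ^+ 2 * B ^+ 2 * r.+1%:R * Y = (L * B) ^+ 2 * (r.+1%:R * Y) by ring.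
rewrite ler_wpM2l ?sqr_ge0//; apply: le_trans (sqr_sum_le _) _.
rewrite ler_wpM2l//; apply: ler_sum => i _.
by rewrite sqr_sum_in_cell.
Qed.

End bump_sum.

Section ae_integral.
Context d (T : measurableType d) (R : realType).
Variable mu : {measure set T -> \bar R}.
Local Open Scope ereal_scope.
Import HBNNSimple.

(** The integral of [f] is a supremum over simple functions below [f], each of which is almost
    everywhere below the measurable [g]. *)
Lemma ae_ge0_integral_le (f g : T -> \bar R) :
  (forall x, 0 <= f x) -> (forall x, 0 <= g x) -> measurable_fun setT g ->
  {ae mu, forall x, f x <= g x} -> \int[mu]_x f x <= \int[mu]_x g x.
Proof.
move=> f0 g0 mg fg; rewrite ge0_integralTE//; apply: ge_ereal_sup => _ [h /= hf <-].
rewrite -integralT_nnsfun; apply: ae_ge0_le_integral => //.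
- by move=> x _; rewrite lee_fin; exact: fun_ge0.
- by apply/measurable_EFinP; exact: measurable_funPT.
- have fltr := ae_filter_ringOfSetsType mu.
  by apply: filterS fg => x fgx _; exact: le_trans (hf x) fgx.
Qed.

End ae_integral.

Section cells.
Context {R : realType}.
Variables (a w : R).
Hypothesis w0 : 0 < w.

Lemma in_cellE (j : nat) :
  [set t | in_cell a w j t] = `]a + j%:R * w, a + j.+1%:R * w]%classic.
Proof.
apply/seteqP; split => t; rewrite /in_cell /= in_itv/=.
  move=> /andP[h1 h2]; apply/andP; split.
    by move: h1; rewrite subr_gt0 ltr_pdivlMr//; lra.
  by move: h2; rewrite lerBlDr -[1 + _]addrC natr1 ler_pdivrMr//; lra.
move=> /andP[h1 h2]; apply/andP; split.
  by rewrite subr_gt0 ltr_pdivlMr//; lra.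
by rewrite lerBlDr -[1 + _]addrC natr1 ler_pdivrMr//; lra.
Qed.

Lemma measurable_in_cell (j : nat) :
  measurable ([set t | in_cell a w j t] : set (measurableTypeR R)).
Proof. by rewrite in_cellE; exact: measurable_itv. Qed.

Lemma lebesgue_measure_in_cell (j : nat) :
  (@lebesgue_measure R) [set t | in_cell a w j t] = w%:E.
Proof.
rewrite in_cellE lebesgue_measure_itv/= lte_fin ltrD2l ltr_pM2r// ltr_nat ltnSn.
by rewrite -EFinD; congr EFin; rewrite -natr1; ring.
Qed.

Lemma measurable_bump r j :
  measurable_fun [set: measurableTypeR R] (fun t : R => bump r ((t - a) / w - j%:R)).
Proof.
have mt : measurable_fun [set: measurableTypeR R] (fun t : R => (t - a) / w - j%:R).
  by apply: measurable_funB => //; apply: measurable_funM => //; apply: measurable_funB.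
rewrite (_ : (fun t : R => _) = (fun t => (((t - a) / w - j%:R) ^+ r *
    (1 - ((t - a) / w - j%:R)) ^+ r) * \1_[set t | in_cell a w j t] t)).
  apply: measurable_funM; last by apply: measurable_indic; exact: measurable_in_cell.
  apply: measurable_funM; apply: measurable_funX => //.
  exact: measurable_funB.
apply/funext => t; rewrite /bump indicE.
case: ifPn => h; first by rewrite mem_set ?mulr1.
by rewrite memNset ?mulr0//= /in_cell; apply/negP.
Qed.

Lemma measurable_bump_sum r M (c : 'I_M -> R) :
  measurable_fun [set: measurableTypeR R] (bump_sum r a w c).
Proof.
apply: measurable_sum => j; apply: measurable_funM => //.
exact: measurable_bump.
Qed.

End cells.

Section step_integral.
Context d (T : measurableType d) (R : realType).
Variable mu : {measure set T -> \bar R}.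

Lemma integral_sum_indic (I : finType) (c : I -> R) (A : I -> set T) :
  (forall j, 0 <= c j) -> (forall j, measurable (A j)) ->
  (\int[mu]_x (\sum_j c j * \1_(A j) x)%:E = \sum_j (c j)%:E * mu (A j))%E.
Proof.
move=> c0 mA.
transitivity (\int[mu]_x \sum_j ((c j)%:E * (\1_(A j) x)%:E))%E.
  by apply: eq_integral => x _; rewrite sumEFin.
rewrite ge0_integral_sum//=.
- apply: eq_bigr => j _; rewrite ge0_integralZl//.
  + by rewrite integral_indic// setIT.
  + by apply/measurable_EFinP; exact: measurable_indic.
  + by rewrite lee_fin.
- move=> j; apply/measurable_EFinP; apply: measurable_funM => //.
- by move=> j x _; rewrite lee_fin mulr_ge0.
Qed.

End step_integral.

Section bump_sum_integral.
Context {R : realType}.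
Variables (a b : R) (M r : nat) (c : 'I_M -> R).
Hypotheses (ab : a < b) (M0 : (0 < M)%N).
Let w := (b - a) / M%:R.

Let M0' : 0 < M%:R :> R. Proof. by rewrite ltr0n. Qed.
Let w0 : 0 < w. Proof. by rewrite divr_gt0// subr_gt0. Qed.
Let Mw : M%:R * w = b - a. Proof. by rewrite mulrCA divff ?mulr1// gt_eqF. Qed.

Lemma in_cell_sub (j : 'I_M) t : in_cell a w j t -> a <= t <= b.
Proof.
have := in_cellE a w0 j; move=> /seteqP[+ _] => /(_ t)/= /[apply].
rewrite in_itv/= => /andP[h1 h2].
have j0 : 0 <= j%:R * w by rewrite mulr_ge0// ltW.
have jM : j.+1%:R * w <= b - a by rewrite -Mw ler_pM2r// ler_nat.
lra.
Qed.

Let leb_cell (j : nat) : (leb a b [set t | in_cell a w j t] <= w%:E)%E.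
Proof.
by rewrite -(lebesgue_measure_in_cell a w0 j); apply: leb_le; exact: measurable_in_cell.
Qed.

Lemma integral_sqr_bump_sum_le :
  (\int[leb a b]_t (bump_sum r a w c t ^+ 2)%:E <= ((\sum_(j < M) c j ^+ 2) * w)%:E)%E.
Proof.
apply: (@le_trans _ _ (\int[leb a b]_t
    (\sum_(j < M) c j ^+ 2 * \1_[set t | in_cell a w j t] t)%:E)%E).
  apply: ge0_integral_le => t; first by rewrite lee_fin sqr_ge0.
  rewrite lee_fin sqr_bump_sum; apply: ler_sum => j _.
  rewrite ler_wpM2l ?sqr_ge0// indicE; have [ht|hN] := boolP (in_cell a w j t).
    by rewrite mem_set// exprn_ile1 ?bump_ge0 ?bump_le1.
  by rewrite bump_notin_cell// expr0n.
rewrite integral_sum_indic; last by move=> j; exact: measurable_in_cell.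
  rewrite mulr_suml -sumEFin; apply: lee_sum => j _.
  rewrite [leRHS]EFinM; apply: lee_wpmul2l; first by rewrite lee_fin sqr_ge0.
  exact: leb_cell.
by move=> j; rewrite sqr_ge0.
Qed.

(** On the middle half of a cell, of length [w / 2], both [u] and [1 - u] are at least 1/4, so the
    bump is at least [16^-1 ^+ r]. *)
Lemma integral_sqr_bump_sum_ge :
  (((16^-1 ^+ r) ^+ 2 * ((\sum_(j < M) c j ^+ 2) * (w / 2)))%:E <=
  \int[leb a b]_t (bump_sum r a w c t ^+ 2)%:E)%E.
Proof.
pose mid (j : 'I_M) : set (measurableTypeR R) :=
  `]a + j%:R * w + w / 4, a + j%:R * w + w * 3 / 4]%classic.
have midE j t : mid j t -> 1 / 4 <= (t - a) / w - j%:R <= 3 / 4.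
  rewrite /mid/= in_itv/= => /andP[h1 h2].
  by rewrite lerBrDr lerBlDr ler_pdivlMr// ler_pdivrMr//; lra.
apply: (@le_trans _ _ (\int[leb a b]_t
    (\sum_(j < M) ((16^-1 ^+ r) ^+ 2 * c j ^+ 2) * \1_(mid j) t)%:E)%E); last first.
  apply: ge0_integral_le => t.
    by rewrite lee_fin; apply: sumr_ge0 => j _; rewrite mulr_ge0// mulr_ge0 ?sqr_ge0.
  rewrite lee_fin sqr_bump_sum; apply: ler_sum => j _.
  rewrite indicE; case: (boolP (t \in mid j)) => [/set_mem/midE/andP[h1 h2]|_]; last first.
    by rewrite mulr0 mulr_ge0 ?sqr_ge0.
  rewrite mulr1 mulrC ler_wpM2l ?sqr_ge0// ler_sqr ?nnegrE ?exprn_ge0 ?bump_ge0//.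
  rewrite /bump ifT; last by lra.
  rewrite -exprMn lerXn2r ?nnegrE; [| lra | nra | nra].
  done.
rewrite integral_sum_indic.
- rewrite mulr_suml mulr_sumr -sumEFin; apply: lee_sum => j _.
  have -> : 16^-1 ^+ r ^+ 2 * (c j ^+ 2 * (w / 2)) =
      (16^-1 ^+ r ^+ 2 * c j ^+ 2) * (w / 2) by rewrite !mulrA.
  rewrite [leLHS]EFinM; apply: lee_wpmul2l.
    by rewrite lee_fin mulr_ge0 ?sqr_ge0.
  suff midL : leb a b (mid j) = (w / 2)%:E by rewrite -midL.
  rewrite lebE (_ : mid j `&` _ = mid j); last first.
    apply/seteqP; split => [t []//|t mt]; split=> //.
    have /andP[h1 h2] := midE _ _ mt; rewrite /= in_itv/=.
    by apply: (@in_cell_sub j); rewrite /in_cell; lra.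
  rewrite /mid lebesgue_measure_itv/= lte_fin ltrD2l ifT; last first.
    by have ww0 : 0 < w := w0; clearbody w; lra.
  by rewrite -EFinD; congr EFin; field.
- by move=> j; rewrite mulr_ge0 ?sqr_ge0.
- by move=> j; exact: measurable_itv.
Qed.

End bump_sum_integral.

(** * Weighted modulus of smoothness of a sum of bumps *)

Section smoothness.
Context {R : realType}.
Variables (a b : R) (M r : nat) (c : 'I_M -> R) (alpha L : R).
Hypotheses (ab : a < b) (M0 : (0 < M)%N) (r0 : (0 < r)%N) (L0 : 0 <= L) (alpha0 : 0 <= alpha).
Hypothesis fL : forall x h : R, 0 <= h -> `|fdiff r h (bump r) x| <= L * h `^ alpha.
Let w := (b - a) / M%:R.

Let M0' : 0 < M%:R :> R. Proof. by rewrite ltr0n. Qed.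
Let w0 : 0 < w. Proof. by rewrite divr_gt0// subr_gt0. Qed.

Lemma fdiff_cst h k x : fdiff r h (fun=> k) x = 0 :> R.
Proof.
have := @fdiff_poly R r h x k%:P (leq_trans (size_polyC_leq1 _) r0).
by rewrite /fdiff; under eq_bigr do rewrite hornerC.
Qed.

(** The pointwise bound on differences is integrated cell by cell: for each of the [r.+1] stencil
    points, the set of [x] sending it into a given cell has measure at most [4 * w]. The constant
    [k] is annihilated by the difference. *)
Lemma sdiff_integral_le (f : R -> R) (k kappa h : R) : 0 < h ->
  {ae leb a b, forall t, f t = k + kappa * bump_sum r a w c t} ->
  (\int[leb a b]_x (sdiff a b r (h * phi a b x) f x ^+ 2)%:E <=
   (kappa ^+ 2 * (L ^+ 2 * (h * M%:R) `^ (2 * alpha) * r.+1%:R) *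
     (r.+1%:R * ((\sum_(j < M) c j ^+ 2) * (4 * w))))%:E)%E.
Proof.
move=> h0 [N [mN N0 fN]].
pose m := r%:R * h / 2.
pose T (i : 'I_r.+1) : R -> R := fun x => x + ((i%:R - r%:R / 2) * h) * phi a b x.
have Tm (i : 'I_r.+1) : `|(i%:R - r%:R / 2) * h| <= m.
  rewrite normrM (gtr0_norm h0) /m mulrAC (ler_wpM2r (ltW h0))// ler_norml.
  have : i%:R <= r%:R :> R by rewrite ler_nat -ltnS.
  by have : 0 <= i%:R :> R by []; lra.
have Titv i x : stencil a b m x -> a <= T i x <= b.
  move=> [/[dup] /phi_gt0 p0 /andP[ax xb] [h1 h2]]; have := Tm i.
  by rewrite ler_norml /T => /andP[h3 h4]; apply/andP; split; nra.
pose K := kappa ^+ 2 * (L ^+ 2 * (h * M%:R) `^ (2 * alpha) * r.+1%:R).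
have K0 : 0 <= K.
  rewrite mulr_ge0 ?sqr_ge0// mulr_ge0// mulr_ge0 ?powR_ge0 ?sqr_ge0//.
pose A (ij : 'I_r.+1 * 'I_M) : set (measurableTypeR R) :=
  T ij.1 @^-1` [set t | in_cell a w ij.2 t] `&` stencil a b m.
have mpre i (B : set (measurableTypeR R)) : measurable B ->
    measurable (T i @^-1` B `&` stencil a b m : set (measurableTypeR R)).
  move=> mB; apply: measurableI; last exact: measurable_stencil.
  rewrite -[X in measurable X]setTI.
  by apply: (measurable_shift a b ((i%:R - r%:R / 2) * h)).
have mA ij : measurable (A ij) by apply: mpre; exact: measurable_in_cell.
(* The bound of [fdiff_bump_sum_le] as a step function: its indicators are those of preimages of
   cells under the maps [T i]. *)
pose G x := \sum_ij (K * c ij.2 ^+ 2) * \1_(A ij) x.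
have G0 x : 0 <= G x.
  by apply: sumr_ge0 => ij _; rewrite mulr_ge0// mulr_ge0 ?sqr_ge0.
apply: (@le_trans _ _ (\int[leb a b]_x (G x)%:E)%E); last first.
  rewrite /G integral_sum_indic//; last by move=> ij; rewrite mulr_ge0 ?sqr_ge0.
  have lebA ij : (leb a b (A ij) <= (4 * w)%:E)%E.
    apply: le_trans (leb_le a b (mA ij)) _.
    rewrite EFinM -(lebesgue_measure_in_cell a w0 ij.2).
    by apply: stencil_preimage_le (Tm _) _; exact: measurable_in_cell.
  apply: (@le_trans _ _ (\sum_ij ((K * c ij.2 ^+ 2) * (4 * w))%:E)%E).
    apply: lee_sum => ij _; rewrite [leRHS]EFinM; apply: lee_wpmul2l (lebA ij).
    by rewrite lee_fin mulr_ge0 ?sqr_ge0.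
  rewrite sumEFin lee_fin -(pair_bigA _ (fun i j => (K * c j ^+ 2) * (4 * w)))/=.
  rewrite sumr_const card_ord -mulr_suml -mulr_sumr -/K -[leLHS]mulr_natl.
  by rewrite le_eqVlt; apply/orP; left; apply/eqP; ring.
apply: ae_ge0_integral_le.
- by move=> x; rewrite lee_fin sqr_ge0.
- by move=> x; rewrite lee_fin.
- apply/measurable_EFinP; apply: measurable_sum => ij; apply: measurable_funM => //.
pose N' := N `&` `[a, b]%classic : set (measurableTypeR R).
have mN' : measurable N' by apply: measurableI => //; exact: measurable_itv.
have fltr := ae_filter_ringOfSetsType (leb a b).
(* For almost every [x] no stencil point falls where [f] differs from the explicit function:
   preimages of null sets are null. Only the part of [N] inside the interval is known to be null,
   and [Titv] keeps the stencil there. *)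
have aeN : {ae leb a b, forall x, forall i, ~ (T i @^-1` N' `&` stencil a b m) x}.
  apply: filter_forall => i; exists (T i @^-1` N' `&` stencil a b m); split.
  - exact: mpre.
  - apply: leb_eq0; first exact: mpre.
    have N'0 : (@lebesgue_measure R) N' = 0%E := N0.
    by have := stencil_preimage_le a b (Tm i) mN'; rewrite N'0 mule0.
  - by move=> x /= /contrapT.
have aeab : {ae leb a b, forall x, a < x < b}.
  have ae1 y : {ae leb a b, forall x, x != y}.
    exists [set y]; split; first exact: measurable_set1.
    - by apply: leb_eq0; [exact: measurable_set1|rewrite lebesgue_measure_set1].
    - by move=> x /= /negP; rewrite negbK => /eqP.
  apply: filterS3 (ae1 a) (ae1 b) (@ae_leb_itv R a b (fun x => a <= x <= b) (fun x h => h)).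
  by move=> x xa xb /andP[ax bx]; rewrite !lt_neqAle ax bx xb eq_sym xa.
apply: filterS2 aeN aeab => x xN xab.
rewrite lee_fin.
have [Sx|Sx] := pselect (stencil a b m x); last first.
  rewrite /sdiff ifF ?expr0n//; apply/negbTE/negP => /andP[].
  rewrite !in_itv/= (_ : r%:R * (h * phi a b x) / 2 = m * phi a b x); last first.
    by rewrite /m; field.
  move=> /andP[_ h1] /andP[h2 _]; apply: Sx; split=> //.
  by move: h1 h2; rewrite -!lerBrDl => h1; rewrite lerBrDl -lerBrDr => h2; split; lra.
have p0 := phi_gt0 xab.
have mp : r%:R * (h * phi a b x) / 2 = m * phi a b x by rewrite /m; field.
rewrite /sdiff mp ifT; last first.
  have [_ [h1 h2]] := Sx; have mp0 : 0 <= m * phi a b x.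
    by rewrite mulr_ge0 ?(ltW p0)// /m !mulr_ge0// ltW.
  by rewrite !in_itv/=; apply/andP; split; apply/andP; split; lra.
have fE : \sum_(i < r.+1) 'C(r, i)%:R * (-1) ^+ i *
    f (x + (i%:R - r%:R / 2) * (h * phi a b x)) =
    kappa * fdiff r (h * phi a b x) (bump_sum r a w c) x.
  transitivity (fdiff r (h * phi a b x)
      (fun t => k + kappa * bump_sum r a w c t) x).
    apply: eq_bigr => i _; congr (_ * _).
    have := xN i; rewrite mulrA => xNi; apply: contrapT => fu; apply: xNi; split=> //.
    split; first exact: fN.
    by rewrite /= in_itv/=; exact: Titv.
  rewrite fdiffD fdiff_cst add0r /fdiff mulr_sumr; apply: eq_bigr => i _; ring.
rewrite fE exprMn.
have H0 : 0 <= h * phi a b x by rewrite mulr_ge0// ltW.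
apply: (le_trans (ler_wpM2l (sqr_ge0 kappa) (fdiff_bump_sum_le a c w0 L0 fL x H0))).
have -> : G x = K * \sum_(i < r.+1) \sum_(j < M)
    c j ^+ 2 * (in_cell a w j (x + (i%:R - r%:R / 2) * (h * phi a b x)))%:R.
  rewrite pair_bigA/= mulr_sumr; apply: eq_bigr => ij _.
  rewrite mulrA; congr (_ * _); rewrite indicE; congr (nat_of_bool _)%:R.
  rewrite mulrA; apply/idP/idP; first by move=> /set_mem[].
  by move=> hc; apply/mem_set; split.
rewrite mulrA ler_wpM2r//.
  by apply: sumr_ge0 => i _; apply: sumr_ge0 => j _; rewrite mulr_ge0 ?sqr_ge0.
rewrite /K ler_wpM2l ?sqr_ge0// ler_wpM2r// ler_wpM2l ?sqr_ge0//.
apply: ge0_ler_powR; first by rewrite mulr_ge0.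
- by rewrite nnegrE divr_ge0// ltW.
- by rewrite nnegrE mulr_ge0// ltW.
(* As [w] is [(b - a) / M%:R], this bounds the ratio of the step [h * phi a b x] to the cell width
   by [h * M%:R]. *)
have pb : phi a b x <= b - a.
  by apply: phi_le; case/andP: xab => ax xb; rewrite (ltW ax) (ltW xb).
rewrite -mulrA ler_wpM2l ?(ltW h0)// ler_pdivrMr// /w mulrCA divff ?mulr1//.
by rewrite gt_eqF.
Qed.

End smoothness.

(** * Closeness of the mixtures *)

Section bounded_integration.
Context {R : realType}.
Variables (a b : R).
Hypothesis ab : a < b.
Implicit Types f g : R -> R.

(** A class stable under sums, products and powers on which integrals are finite, so that
    integration becomes linear with real values. *)
Definition bounded_meas f := measurable_fun [set: measurableTypeR R] f /\
  exists K : R, forall t, a <= t <= b -> `|f t| <= K.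

Lemma bounded_meas_cst k : bounded_meas (fun=> k).
Proof. by split=> //; exists `|k|. Qed.

Lemma bounded_meas_id : bounded_meas (fun t => t).
Proof.
split=> //; exists (`|a| + `|b|) => t /andP[at_ tb].
have := ler_norm b; have := ler_norm (- a); rewrite normrN.
have := normr_ge0 a; have := normr_ge0 b.
by move=> h1 h2 h3 h4; rewrite ler_norml; apply/andP; split; lra.
Qed.

Lemma bounded_measD f g : bounded_meas f -> bounded_meas g ->
  bounded_meas (fun t => f t + g t).
Proof.
move=> [mf [K fK]] [mg [K' gK']]; split; first exact: measurable_funD.
exists (K + K') => t tab; rewrite (le_trans (ler_normD _ _))// lerD//.
  exact: fK.
exact: gK'.
Qed.

Lemma bounded_measM f g : bounded_meas f -> bounded_meas g ->
  bounded_meas (fun t => f t * g t).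
Proof.
move=> [mf [K fK]] [mg [K' gK']]; split; first exact: measurable_funM.
by exists (K * K') => t tab; rewrite normrM ler_pM ?fK ?gK'.
Qed.

Lemma bounded_measX f n : bounded_meas f -> bounded_meas (fun t => f t ^+ n).
Proof.
move=> bf; elim: n => [|n IH]; first exact: bounded_meas_cst.
rewrite (_ : (fun t => _) = (fun t => f t * f t ^+ n)); first exact: bounded_measM.
by apply/funext => t; rewrite exprS.
Qed.

Lemma bounded_meas_sum n (f : 'I_n -> R -> R) : (forall i, bounded_meas (f i)) ->
  bounded_meas (fun t => \sum_(i < n) f i t).
Proof.
move=> bf; split; first by apply: measurable_sum => i; exact: (bf i).1.
have /choice[K fK] : forall i, exists K : R, forall t, a <= t <= b -> `|f i t| <= K.
  by move=> i; exact: (bf i).2.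
exists (\sum_(i < n) K i) => t tab; rewrite (le_trans (ler_norm_sum _ _ _))//.
by apply: ler_sum => i _; exact: fK.
Qed.

Lemma bounded_meas_integrable f : bounded_meas f ->
  (leb a b).-integrable [set: measurableTypeR R] (EFin \o f).
Proof.
move=> [mf [K fK]]; apply/integrableP; split; first exact/measurable_EFinP.
have : (\int[leb a b]_x `|K|%:E < +oo)%E by rewrite integral_leb_cst// ltry.
apply: le_lt_trans; apply: ae_ge0_integral_le => //.
apply: ae_leb_itv => t /fK tK; rewrite /= lee_fin.
exact: le_trans tK (ler_norm _).
Qed.

Definition lint f : R := (\int[leb a b]_t f t)%R.

Lemma lintE f : bounded_meas f -> (\int[leb a b]_t (f t)%:E = (lint f)%:E)%E.
Proof.
move=> bf; rewrite /lint /Rintegral fineK//.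
by apply: integrable_fin_num => //; exact: bounded_meas_integrable.
Qed.

Lemma lintD f g : bounded_meas f -> bounded_meas g ->
  lint (fun t => f t + g t) = lint f + lint g.
Proof. by move=> bf bg; apply: RintegralD => //; exact: bounded_meas_integrable. Qed.

Lemma lintZ k f : bounded_meas f -> lint (fun t => k * f t) = k * lint f.
Proof. by move=> bf; apply: RintegralZl => //; exact: bounded_meas_integrable. Qed.

Lemma lint_cst k : lint (fun=> k) = k * (b - a).
Proof.
by have := lintE (bounded_meas_cst k); rewrite integral_leb_cst// => -[].
Qed.

Lemma lint_sum n (f : 'I_n -> R -> R) : (forall i, bounded_meas (f i)) ->
  lint (fun t => \sum_(i < n) f i t) = \sum_(i < n) lint (f i).
Proof.
elim: n f => [|n IH] f bf.
  rewrite big_ord0 (_ : (fun t => _) = fun=> 0) ?lint_cst ?mul0r//.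
  by apply/funext => t; rewrite big_ord0.
rewrite big_ord_recl -IH// -lintD//.
  by congr lint; apply/funext => t; rewrite big_ord_recl.
exact: bounded_meas_sum.
Qed.

Lemma lint_ge0 f : bounded_meas f -> (forall t, a <= t <= b -> 0 <= f t) ->
  0 <= lint f.
Proof.
move=> bf f0; rewrite -lee_fin -lintE//.
rewrite (_ : (\int[leb a b]_t (f t)%:E = \int[leb a b]_t `|f t|%:E)%E).
  by apply: integral_ge0 => t _; rewrite lee_fin.
apply: ae_eq_integral => //.
- by apply/measurable_EFinP; exact: bf.1.
- by apply/measurable_EFinP; apply: measurableT_comp => //; exact: bf.1.
- by apply: ae_leb_itv => t /f0 ft _; rewrite ger0_norm.
Qed.

Lemma lint_le f g : bounded_meas f -> bounded_meas g ->
  (forall t, a <= t <= b -> f t <= g t) -> lint f <= lint g.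
Proof.
move=> bf bg fg; rewrite -subr_ge0 -mulN1r -lintZ// -lintD//; last first.
  by apply: bounded_measM => //; exact: bounded_meas_cst.
apply: lint_ge0 => [|t /fg]; last by rewrite mulN1r subr_ge0.
apply: bounded_measD => //.
by apply: bounded_measM => //; exact: bounded_meas_cst.
Qed.

Lemma lint_ae_eq f g : measurable_fun [set: measurableTypeR R] f ->
  bounded_meas g ->
  {ae leb a b, forall t, f t = g t} -> (\int[leb a b]_t (f t)%:E = (lint g)%:E)%E.
Proof.
move=> mf bg fg; rewrite -lintE//; apply: ae_eq_integral => //.
- exact/measurable_EFinP.
- by apply/measurable_EFinP; exact: bg.1.
- have fltr := ae_filter_ringOfSetsType (leb a b).
  by apply: filterS fg => t /= ->.
Qed.

End bounded_integration.

Section exp_tail.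
Context {R : realType}.

(** For [k >= K] the factor [e ^ (k - K)] is at least 1, so the tail is at most [e ^- K] times the
    exponential series at [e * u]. The bound is proved for partial sums and passes to the limit. *)
Lemma expR_taylor_tail (u : R) K : 0 <= u ->
  `|expR (- u) - \sum_(k < K) (- u) ^+ k / k`!%:R| <= expR (expR 1 * u - K%:R).
Proof.
move=> u0; set e := expR 1.
have e1 : 1 <= e by rewrite /e -expR0 ler_expR.
have e0 : 0 < e by apply: lt_le_trans e1.
have eu0 : 0 <= e * u by rewrite mulr_ge0// ltW.
have cu := @is_cvg_series_exp_coeff R (- u).
have cK : (fun n => `|series (exp_coeff (- u)) n - \sum_(k < K) (- u) ^+ k / k`!%:R|)
    @ \oo --> `|expR (- u) - \sum_(k < K) (- u) ^+ k / k`!%:R|.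
  by apply: cvg_norm; apply: cvgB => //; exact: cvg_cst.
apply: (@closed_cvg _ _ \oo%classic _ _ (fun y => y <= expR (e * u - K%:R)) _ _ _ cK).
  exact: closed_le.
near=> n.
have Kn : (K <= n)%N by near: n; exact: nbhs_infty_ge.
rewrite /series/= -(big_mkord xpredT (fun k => (- u) ^+ k / k`!%:R)).
rewrite (big_cat_nat (n := K))//= addrAC subrr add0r.
rewrite (le_trans (ler_norm_sum _ _ _))//.
apply: (@le_trans _ _ (\sum_(K <= k < n) (e ^- K * exp_coeff (e * u) k))).
  apply: ler_sum_nat => k /andP[Kk kn].
  rewrite /exp_coeff/= normrM normrX normrN (ger0_norm u0) normfV normr_nat.
  rewrite mulrA ler_wpM2r ?invr_ge0// exprMn mulrA ler_peMl ?exprn_ge0//.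
  by rewrite -(subnK Kk) exprD mulrCA mulVf ?mulr1 ?exprn_ege1// expf_neq0// gt_eqF.
have -> : expR (e * u - K%:R) = e ^- K * expR (e * u).
  by rewrite expRD mulrC expRN -[K%:R]mulr1 expRM_natl.
rewrite -mulr_sumr ler_wpM2l ?invr_ge0 ?exprn_ge0 ?(ltW e0)//.
apply: (@le_trans _ _ (series (exp_coeff (e * u)) n)).
  rewrite /series/= [leRHS](big_cat_nat (n := K))//= lerDr.
  by apply: sumr_ge0 => k _; exact: exp_coeff_ge0.
apply: nondecreasing_cvgn_le; last exact: is_cvg_series_exp_coeff.
by apply: nondecreasing_series => k _ _; exact: exp_coeff_ge0.
Unshelve. all: by end_near. Qed.

End exp_tail.

Section oscillation.
Context {R : realType}.
Variables a b : R.
Hypotheses (a0 : 0 < a) (ab : a < b).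

(** Solves [tilt * (expR 1 * b + a) = a / 2]. Weighting the exponents [expR 1 * (b * x) - K%:R] and
    [- (a * x)] by [tilt] and [1 - tilt] then gives exactly [- (tilt * K%:R) - a / 2 * x]. *)
Let tilt : R := a / (2 * (expR 1 * b + a)).

Lemma bounded_meas_expR (x : R) : bounded_meas a b (fun t => expR (- (t * x))).
Proof.
split.
  by apply: measurableT_comp => //; apply: measurableT_comp => //; apply: measurable_funM.
exists (expR (`|a * x| + `|b * x|)) => t /andP[at_ tb].
rewrite ger0_norm ?expR_ge0// ler_expR.
have h1 := ler_norm (- (a * x)); have h2 := ler_norm (- (b * x)).
rewrite !normrN in h1 h2; have := normr_ge0 (a * x); have := normr_ge0 (b * x).
have [x0|x0] := leP 0 x; nra.
Qed.

(* The two bounds come from the decay of the exponential and from its Taylor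
   expansion; the tilt is the geometric mean weight making the product decay in
   both the degree and the observation. *)
Lemma orthogonal_mixture_le (p : R -> R) K (x : R) : 0 <= x ->
  bounded_meas a b p -> (forall t, a <= t <= b -> `|p t| <= (b - a)^-1) ->
  (forall k : nat, (k <= K)%N -> lint a b (fun t => p t * t ^+ k) = 0) ->
  lint a b (fun t => p t * (t * expR (- (t * x)))) <=
  b * expR (- (tilt * K%:R) - a / 2 * x).
Proof.
move=> x0 bp p_le p_orth.
have b0 : 0 < b by apply: lt_trans ab.
have ba : 0 < b - a by rewrite subr_gt0.
have bound (q : R -> R) (B : R) : bounded_meas a b q ->
    (forall t, a <= t <= b -> `|q t| <= B) ->
    lint a b (fun t => p t * (t * q t)) <= b * B.
  move=> bq qB; have -> : b * B = lint a b (fun=> (b - a)^-1 * (b * B)).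
    by rewrite lint_cst// mulrAC mulVf ?mul1r// gt_eqF.
  apply: lint_le => //.
  - by apply: bounded_measM => //; apply: bounded_measM => //; exact: bounded_meas_id.
  - exact: bounded_meas_cst.
  - move=> t tab; have tb := qB _ tab; apply: (le_trans (ler_norm _)).
    rewrite normrM ler_pM// ?p_le// normrM ler_pM// ger0_norm; case/andP: tab => //.
    by move=> at_ _; apply: ltW; exact: lt_le_trans at_.
have decay : lint a b (fun t => p t * (t * expR (- (t * x)))) <= b * expR (- (a * x)).
  apply: bound => [|t /andP[at_ tb]]; first exact: bounded_meas_expR.
  by rewrite ger0_norm ?expR_ge0// ler_expR lerN2 ler_wpM2r.
pose taylor t := \sum_(k < K) (- (t * x)) ^+ k / k`!%:R.
have bpow k : bounded_meas a b (fun t => t ^+ k).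
  by apply: bounded_measX; exact: bounded_meas_id.
have btaylor : bounded_meas a b taylor.
  apply: bounded_meas_sum => k; apply: bounded_measM; last exact: bounded_meas_cst.
  apply: bounded_measX; rewrite (_ : (fun t => _) = fun t => - x * t).
    by apply: bounded_measM; [exact: bounded_meas_cst|exact: bounded_meas_id].
  by apply/funext => t; ring.
(* The factor [t] of the exponential density raises each degree by one: the terms [k < K] use the
   moments of [p] of orders 1 to [K]. *)
have taylor0 : lint a b (fun t => p t * (t * taylor t)) = 0.
  rewrite (_ : (fun t => _) = fun t => \sum_(k < K) ((- x) ^+ k / k`!%:R) * (p t * t ^+ k.+1)).
    rewrite lint_sum//.
      rewrite big1// => k _; rewrite lintZ//; last exact: bounded_measM.
      by rewrite p_orth ?mulr0.
    by move=> k; apply: bounded_measM; [exact: bounded_meas_cst|exact: bounded_measM].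
  apply/funext => t; rewrite /taylor !mulr_sumr; apply: eq_bigr => k _.
  by rewrite -mulrN exprMn exprS; ring.
have flat : lint a b (fun t => p t * (t * expR (- (t * x)))) <=
    b * expR (expR 1 * (b * x) - K%:R).
  rewrite (_ : lint _ _ _ = lint a b (fun t => p t * (t * (expR (- (t * x)) - taylor t)))).
    apply: bound => [|t /andP[at_ tb]].
      apply: bounded_measD; first exact: bounded_meas_expR.
      rewrite (_ : (fun t => _) = fun t => -1 * taylor t).
        by apply: bounded_measM => //; exact: bounded_meas_cst.
      by apply/funext => t; rewrite mulN1r.
    have tx0 : 0 <= t * x by rewrite mulr_ge0// ltW// (lt_le_trans a0).
    apply: (le_trans (expR_taylor_tail K tx0)).
    by rewrite ler_expR lerD2r ler_wpM2l ?expR_ge0// ler_wpM2r.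
  rewrite -[LHS]subr0 -taylor0 -mulN1r -lintZ//; last first.
    by apply: bounded_measM => //; apply: bounded_measM => //; exact: bounded_meas_id.
  rewrite -lintD//.
  - by congr lint; apply/funext => t; ring.
  - apply: bounded_measM => //; apply: bounded_measM; first exact: bounded_meas_id.
    exact: bounded_meas_expR.
  - apply: bounded_measM; first exact: bounded_meas_cst.
    by apply: bounded_measM => //; apply: bounded_measM => //; exact: bounded_meas_id.
have e0 : 0 < expR 1 :> R by rewrite expR_gt0.
have D0 : 0 < expR 1 * b + a by rewrite addr_gt0// mulr_gt0.
have tilt0 : 0 < tilt by rewrite divr_gt0// mulr_gt0.
have tiltE : tilt * (expR 1 * b + a) = a / 2.
  by rewrite /tilt; field; rewrite gt_eqF.
have tilt1 : tilt < 1.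
  rewrite /tilt ltr_pdivrMr ?mulr_gt0// mul1r.
  by have := mulr_gt0 e0 b0; lra.
(* The smaller of the two exponents is at most their weighted mean. *)
have [h|h] := leP (expR 1 * (b * x) - K%:R) (- (a * x)).
  apply: (le_trans flat); rewrite ler_wpM2l ?(ltW b0)// ler_expR.
  nra.
apply: (le_trans decay); rewrite ler_wpM2l ?(ltW b0)// ler_expR.
nra.
Qed.

End oscillation.

Section mixtures.
Context {R : realType}.
Variables (a b : R) (a0 : 0 < a) (ab : a < b).

Lemma exponential_pdf_ge (t x : R) : 0 <= x ->
  exponential_pdf t x = t * expR (- (t * x)).
Proof. by move=> x0; rewrite exponential_pdfE// -mulNr. Qed.

Lemma exponential_pdf_lt (t x : R) : x < 0 -> exponential_pdf t x = 0.
Proof.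
move=> x0; rewrite /exponential_pdf patchE memNset//= in_itv/= andbT.
by apply/negP; rewrite -ltNge.
Qed.

(** Tonelli asks for an integrand that is nonnegative everywhere, whereas the representative of [f]
    is nonnegative only almost everywhere. *)
Let likelihood_norm (f : H1 a b) (z : measurableTypeR R * measurableTypeR R) : \bar R :=
  `|f z.1 * exponential_pdf z.1 z.2|%:E.

Let measurable_likelihood (f : H1 a b) : measurable_fun setT
  (fun z : measurableTypeR R * measurableTypeR R => f z.1 * exponential_pdf z.1 z.2).
Proof.
apply: measurable_funM.
  by apply: measurableT_comp; [exact: measurable_L2_fun|exact: measurable_fst].
rewrite (_ : (fun _ => _) = (fun z : measurableTypeR R * measurableTypeR R =>
   z.1 * expR (- z.1 * z.2) * \1_`[0, +oo[%classic z.2)); last first.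
  apply/funext => z; rewrite /exponential_pdf patchE indicE.
  by case: ifPn; rewrite ?mulr1 ?mulr0.
apply: measurable_funM; last first.
  by apply: measurableT_comp; [exact: measurable_indic|exact: measurable_snd].
apply: measurable_funM; first exact: measurable_fst.
apply: measurableT_comp => //; apply: measurable_funM; last exact: measurable_snd.
by apply: measurableT_comp => //; exact: measurable_fst.
Qed.

Let measurable_likelihood_norm f : measurable_fun setT (likelihood_norm f).
Proof.
by apply/measurable_EFinP; apply: measurableT_comp.
Qed.

Let mixture_pdf_fubini f : mixture_pdf f = fubini_G (leb a b) (likelihood_norm f).
Proof.
apply/funext => x; apply: ae_eq_integral => //.
- apply/measurable_EFinP.
  exact: (measurableT_comp (measurable_likelihood f) (pair2_measurable _)).
- exact: (measurableT_comp (measurable_likelihood_norm f) (pair2_measurable _)).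
- have fltr := ae_filter_ringOfSetsType (leb a b).
  have ae_ab := @ae_leb_itv R a b (fun t => a <= t <= b) (fun t h => h).
  apply: filterS2 (H1_ge0 f) ae_ab => t ft /andP[at_ _] _.
  rewrite /likelihood_norm/= ger0_norm// mulr_ge0//.
  by rewrite exponential_pdf_ge0// (le_trans (ltW a0)).
Qed.

Lemma measurable_mixture_pdf (f : H1 a b) :
  measurable_fun [set: measurableTypeR R] (mixture_pdf f).
Proof.
rewrite mixture_pdf_fubini; apply: measurable_fun_fubini_tonelli_G => // z.
by rewrite lee_fin.
Qed.

Lemma mixture_pdf_ge0 (f : H1 a b) x : (0 <= mixture_pdf f x)%E.
Proof. by rewrite mixture_pdf_fubini; apply: integral_ge0 => t _; rewrite lee_fin. Qed.

Lemma mixture_pdf_lint (f : H1 a b) (u : R -> R) x : 0 <= x ->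
  bounded_meas a b u -> {ae leb a b, forall t, f t = u t} ->
  mixture_pdf f x = (lint a b (fun t => u t * (t * expR (- (t * x)))))%:E.
Proof.
move=> x0 bu fu; rewrite /mixture_pdf.
under eq_integral do rewrite exponential_pdf_ge//.
apply: lint_ae_eq => //.
- apply: measurable_funM; first exact: measurable_L2_fun.
  by apply: measurable_funM => //; exact: (bounded_meas_expR a b x).1.
- apply: bounded_measM => //; apply: bounded_measM; first exact: bounded_meas_id.
  exact: bounded_meas_expR.
- have fltr := ae_filter_ringOfSetsType (leb a b).
  by apply: filterS fu => t ->.
Qed.

(** The excess of one mixture density over the other is at most [b] times an exponential in
    [a / 2 * x], that is, [2 * b / a] times the exponential density of rate [a / 2], of total mass
    1. *)
Lemma mixture_law_close (f0 f1 : H1 a b) (p : R -> R) K :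
  {ae leb a b, forall t, f0 t = (b - a)^-1} ->
  {ae leb a b, forall t, f1 t = (b - a)^-1 - p t} ->
  bounded_meas a b p -> (forall t, a <= t <= b -> `|p t| <= (b - a)^-1) ->
  (forall k : nat, (k <= K)%N -> lint a b (fun t => p t * t ^+ k) = 0) ->
  forall B, measurable B -> (mixture_law a0 f0 B <= mixture_law a0 f1 B +
    (2 * b / a * expR (- (a / (2 * (expR 1 * b + a)) * K%:R)))%:E)%E.
Proof.
move=> f0E f1E bp p_le p_orth B mB.
set tilt := a / _; pose q x := 2 * b / a * expR (- (tilt * K%:R)) * exponential_pdf (a / 2) x.
have b0 : 0 < b by apply: lt_trans ab.
have a20 : 0 < a / 2 by rewrite divr_gt0.
have C0 : 0 <= 2 * b / a * expR (- (tilt * K%:R)).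
  by rewrite mulr_ge0 ?expR_ge0// divr_ge0 ?mulr_ge0// ltW.
have q0 x : 0 <= q x by rewrite mulr_ge0// exponential_pdf_ge0// ltW.
have mq : measurable_fun [set: measurableTypeR R] (EFin \o q).
  apply/measurable_EFinP; apply: measurable_funM => //.
  exact: measurable_exponential_pdf.
have intq : (\int[@lebesgue_measure R]_x (q x)%:E = (2 * b / a * expR (- (tilt * K%:R)))%:E)%E.
  rewrite /q; under eq_integral do rewrite EFinM.
  rewrite ge0_integralZl//.
  - by rewrite integral_exponential_pdf// mule1.
  - by apply/measurable_EFinP; exact: measurable_exponential_pdf.
  - by move=> x _; rewrite lee_fin exponential_pdf_ge0// ltW.
have pdf_le x : (mixture_pdf f0 x <= mixture_pdf f1 x + (q x)%:E)%E.
  have [x0|x0] := leP 0 x; last first.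
    rewrite /mixture_pdf.
    under eq_integral do rewrite exponential_pdf_lt// mulr0.
    under [X in (_ <= X + _)%E]eq_integral do rewrite exponential_pdf_lt// mulr0.
    by rewrite integral0 add0e lee_fin.
  have bk := bounded_meas_cst a b (b - a)^-1.
  have bNp : bounded_meas a b (fun t => (b - a)^-1 - p t).
    apply: bounded_measD => //; rewrite (_ : (fun t => _) = fun t => -1 * p t).
      by apply: bounded_measM => //; exact: bounded_meas_cst.
    by apply/funext => t; rewrite mulN1r.
  have be : bounded_meas a b (fun t => t * expR (- (t * x))).
    by apply: bounded_measM; [exact: bounded_meas_id|exact: bounded_meas_expR].
  rewrite (mixture_pdf_lint x0 bk f0E) (mixture_pdf_lint x0 bNp f1E) -EFinD lee_fin.
  rewrite (_ : lint _ _ _ = lint a b (fun t => ((b - a)^-1 - p t) * (t * expR (- (t * x)))) +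
      lint a b (fun t => p t * (t * expR (- (t * x))))); last first.
    rewrite -lintD//; [|exact: bounded_measM|exact: bounded_measM].
    by congr lint; apply/funext => t; ring.
  rewrite lerD2l (le_trans (orthogonal_mixture_le a0 ab x0 bp p_le p_orth))//.
  rewrite /q exponential_pdf_ge// expRD -/tilt.
  by rewrite le_eqVlt; apply/orP; left; apply/eqP; field; rewrite gt_eqF.
rewrite /mixture_law.
apply: (@le_trans _ _ (\int[lebesgue_measure]_(x in B) (mixture_pdf f1 x + (q x)%:E))%E).
  apply: ge0_le_integral => //.
  - by move=> x _; exact: mixture_pdf_ge0.
  - by apply: measurable_funTS; exact: measurable_mixture_pdf.
  - apply/measurable_funTS/emeasurable_funD => //; exact: measurable_mixture_pdf.
rewrite ge0_integralD//=.
- rewrite leeD2l// -intq; apply: ge0_subset_integral => //.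
  by move=> x _; rewrite lee_fin.
- by move=> x _; exact: mixture_pdf_ge0.
- by apply: measurable_funTS; exact: measurable_mixture_pdf.
- by move=> x _; rewrite lee_fin.
- by apply: measurable_funTS.
Qed.

End mixtures.

(** * The perturbed uniform density *)

Section perturbation.
Context {R : realType}.
Variables (a b : R) (a0 : 0 < a) (ab : a < b).

Lemma bounded_meas_bump_sum r w M (c : 'I_M -> R) : 0 < w ->
  bounded_meas a b (bump_sum r a w c).
Proof.
move=> w0; split; first exact: measurable_bump_sum.
exists (1 + \sum_(j < M) c j ^+ 2) => t _.
have := bump_sum_le r a w c t; have := normr_ge0 (bump_sum r a w c t).
rewrite -[bump_sum _ _ _ _ _ ^+ 2]real_normK ?num_real//.
set S := \sum_(j < M) _; have S0 : 0 <= S by apply: sumr_ge0 => j _; rewrite sqr_ge0.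
nra.
Qed.

(** When the cells fill the interval, this normalization keeps the L2 norm of the sum between
    constants independent of [N]. *)
Lemma exists_orthogonal_bump_sum r w N : 0 < w ->
  exists2 c : 'I_N.+1 -> R, \sum_(j < N.+1) c j ^+ 2 = N.+1%:R &
    forall k, (k < N)%N -> lint a b (fun t => bump_sum r a w c t * t ^+ k) = 0.
Proof.
move=> w0; pose e (j : nat) t := bump r ((t - a) / w - j%:R).
have be j k : bounded_meas a b (fun t => e j t * t ^+ k).
  apply: bounded_measM; last by apply: bounded_measX; exact: bounded_meas_id.
  split; first exact: measurable_bump.
  by exists 1 => t _; rewrite ger0_norm ?bump_ge0// bump_le1.
pose A : 'M[R]_(N.+1, N) := \matrix_(j, k) lint a b (fun t => e j t * t ^+ k).
(* [N] linear conditions on [N + 1] coefficients *)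
have : kermx A != 0.
  rewrite -mxrank_eq0 mxrank_ker -lt0n subn_gt0 ltnS; exact: rank_leq_col.
move=> /rowV0Pn[v /sub_kermxP vA v0].
pose S := \sum_(j < N.+1) v 0 j ^+ 2.
have S0 : 0 < S.
  rewrite lt_neqAle sumr_ge0 ?andbT; last by move=> j _; rewrite sqr_ge0.
  rewrite eq_sym psumr_neq0; last by move=> j _; rewrite sqr_ge0.
  have /rV0Pn[j vj] := v0.
  by apply/hasP; exists j; rewrite ?mem_index_enum//= lt_neqAle sqr_ge0 eq_sym sqrf_eq0 vj.
pose s := Num.sqrt (N.+1%:R / S).
have s2 : s ^+ 2 = N.+1%:R / S by rewrite sqr_sqrtr// divr_ge0// ltW.
exists (fun j => s * v 0 j).
  under eq_bigr do rewrite exprMn.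
  by rewrite -mulr_sumr s2 mulfVK// gt_eqF.
move=> k kN.
rewrite (_ : (fun t => _) = fun t => \sum_(j < N.+1) (s * v 0 j) * (e j t * t ^+ k)); last first.
  by apply/funext => t; rewrite /bump_sum mulr_suml; apply: eq_bigr => j _; rewrite mulrA.
rewrite lint_sum//; last first.
  by move=> j; apply: bounded_measM => //; exact: bounded_meas_cst.
have := congr1 (fun B : 'rV_N => B 0 (Ordinal kN)) vA; rewrite !mxE => vAk.
transitivity (s * \sum_j v 0 j * A j (Ordinal kN)); last by rewrite vAk mulr0.
rewrite mulr_sumr; apply: eq_bigr => j _.
by rewrite lintZ// !mxE mulrA.
Qed.

End perturbation.

Section perturbed_uniform.
Context {R : realType}.
Variables (a b alpha C L delta s : R) (N : nat) (c : 'I_N.+1 -> R).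
Hypotheses (a0 : 0 < a) (ab : a < b) (alpha1 : 1 < alpha).
Hypothesis sum_c : \sum_(j < N.+1) c j ^+ 2 = N.+1%:R.
Let r := (Num.truncn alpha).+1.
Let w := (b - a) / N.+1%:R.
Let g := bump_sum r a w c.
Hypotheses (s0 : 0 < s) (s2 : s ^+ 2 = b - a).
Hypothesis g0 : lint a b g = 0.
Hypotheses (L0 : 0 <= L) (delta0 : 0 <= delta).
Hypothesis fL : forall x h : R, 0 <= h -> `|fdiff r h (bump r) x| <= L * h `^ alpha.
Hypothesis delta_norm : delta * s <= C - s^-1.
Hypothesis delta_modulus : delta * (L * r.+1%:R * 2 * s) <= C.

Let ba : 0 < b - a. Proof. by rewrite subr_gt0. Qed.
Let w0 : 0 < w. Proof. by rewrite divr_gt0// ltr0n. Qed.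
Let Nw : N.+1%:R * w = b - a. Proof. by rewrite mulrCA divff ?mulr1// pnatr_eq0. Qed.
Let N0 : 0 < N.+1%:R :> R. Proof. by rewrite ltr0n. Qed.

(** As [g] has mean 0 the cross term vanishes, and the squared norm is at most
    [s^-1 ^+ 2 + (delta * s) ^+ 2], where [s^-1] is the norm of the uniform density. *)
Lemma L2norm_perturbation (f : L2 a b) (kappa : R) : `|kappa| <= delta ->
  {ae leb a b, forall t, f t = (b - a)^-1 + kappa * g t} ->
  (L2norm a b f <= C%:E)%E.
Proof.
move=> kd fE; have Cs : delta * s + s^-1 <= C by rewrite -lerBrDr.
have ds0 : 0 <= delta * s by rewrite mulr_ge0// ltW.
have si0 : 0 < s^-1 by rewrite invr_gt0.
have C0 : 0 <= C by apply: le_trans Cs; rewrite addr_ge0// ltW.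
apply: L2norm_le => //.
have bg : bounded_meas a b g by exact: bounded_meas_bump_sum.
have bk k : bounded_meas a b (fun=> k) by exact: bounded_meas_cst.
have bu : bounded_meas a b (fun t => (b - a)^-1 + kappa * g t).
  by apply: bounded_measD => //; exact: bounded_measM.
rewrite (integral_sqr_ae_eq _ _ fE); [|exact: measurable_L2_fun|exact: bu.1].
have bg2 : bounded_meas a b (fun t => g t ^+ 2) by exact: bounded_measX.
have g2 : lint a b (fun t => g t ^+ 2) <= b - a.
  have := integral_sqr_bump_sum_le r c ab (ltn0Sn N).
  by rewrite (lintE ab bg2) lee_fin sum_c Nw.
rewrite lintE//; last by apply: bounded_measX.
rewrite (_ : (fun t => _) = (fun t => (b - a)^-1 ^+ 2 +
    ((2 * (b - a)^-1 * kappa) * g t + kappa ^+ 2 * g t ^+ 2))); last first.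
  by apply/funext => t; ring.
have bZ (k : R) q : bounded_meas a b q -> bounded_meas a b (fun t => k * q t).
  by move=> bq; exact: bounded_measM.
rewrite !lintD ?lintZ ?lint_cst//; try exact: bZ; last first.
  by apply: bounded_measD; exact: bZ.
rewrite g0 mulr0 add0r lee_fin.
have -> : (b - a)^-1 * ((b - a)^-1 * (b - a)) = s^-1 ^+ 2.
  by rewrite exprVn s2 mulVf ?mulr1// gt_eqF.
have k2 : kappa ^+ 2 <= delta ^+ 2.
  by rewrite -real_normK ?num_real// ler_sqr ?nnegrE.
apply: (@le_trans _ _ (s^-1 ^+ 2 + (delta * s) ^+ 2)).
  rewrite lerD2l exprMn s2; apply: ler_pM => //; first exact: sqr_ge0.
  by apply: lint_ge0 => // t _; rewrite sqr_ge0.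
apply: (@le_trans _ _ ((delta * s + s^-1) ^+ 2)); last first.
  by rewrite ler_sqr ?nnegrE// addr_ge0// ltW.
rewrite [leRHS](_ : _ = s^-1 ^+ 2 + (delta * s) ^+ 2 + 2 * (delta * s * s^-1)); last by ring.
by rewrite lerDl mulr_ge0// mulr_ge0// ltW.
Qed.

(** Narrow bumps inflate the modulus by the power [alpha] of their number, which the size of [kappa]
    compensates. The squared bound is a perfect square: two factors [r.+1%:R], the 4 of the change
    of variables and [s ^+ 2]. *)
Lemma modulus_perturbation (f : L2 a b) (kappa : R) :
  `|kappa| <= delta * N.+1%:R `^ (- alpha) ->
  {ae leb a b, forall t, f t = (b - a)^-1 + kappa * g t} ->
  forall t : R, 0 < t -> (modulus a b r f t <= (C * t `^ alpha)%:E)%E.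
Proof.
move=> kd fE t t0; apply: ge_ereal_sup => _ [h /= /andP[h0 ht] <-].
have dL0 : 0 <= delta * (L * r.+1%:R * 2 * s) by rewrite !mulr_ge0// ltW.
have C0 : 0 <= C by exact: le_trans dL0 _.
apply: L2norm_le; first by rewrite mulr_ge0 ?powR_ge0.
have alpha0 : 0 <= alpha by rewrite ltW// (lt_trans ltr01).
have H := sdiff_integral_le (c := c) ab (ltn0Sn N) (ltn0Sn _ : (0 < r)%N) L0 alpha0 fL h0 fE.
apply: (le_trans H).
rewrite lee_fin sum_c.
have -> : N.+1%:R * (4 * ((b - a) / N.+1%:R)) = 4 * s ^+ 2.
  by rewrite s2 mulrCA; congr (_ * _); exact: Nw.
have sqrP (x : R) : x `^ (2 * alpha) = (x `^ alpha) ^+ 2.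
  by rewrite -powR_mulrn ?powR_ge0// -powRrM (mulrC alpha).
rewrite sqrP powRM ?(ltW h0)// ?(ltW N0)//.
set P := N.+1%:R `^ alpha; have P0 : 0 < P by rewrite powR_gt0.
have kP : `|kappa| * P <= delta.
  have : `|kappa| * P <= delta * N.+1%:R `^ (- alpha) * P by rewrite ler_wpM2r// ltW.
  by rewrite powRN -/P mulfVK// gt_eqF.
have hP : h `^ alpha <= t `^ alpha.
  by apply: ge0_ler_powR => //; rewrite nnegrE ltW.
rewrite [leLHS](_ : _ = (`|kappa| * P * (L * r.+1%:R * 2 * s) * h `^ alpha) ^+ 2); last first.
  by rewrite -[kappa ^+ 2]real_normK ?num_real//; ring.
have X0 : 0 <= `|kappa| * P * (L * r.+1%:R * 2 * s).
  by rewrite mulr_ge0 ?mulr_ge0// ltW.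
have XC : `|kappa| * P * (L * r.+1%:R * 2 * s) <= C.
  apply: le_trans delta_modulus.
  by rewrite ler_wpM2r// !mulr_ge0// ltW.
have hp0 := powR_ge0 h alpha; have tp0 := powR_ge0 t alpha.
rewrite ler_sqr; first exact: ler_pM.
- by rewrite nnegrE mulr_ge0.
- by rewrite nnegrE mulr_ge0.
Qed.

End perturbed_uniform.

(** * Choice of the constants and of the number of bumps *)

Section lower_bound.
Context {R : realType}.
Variables (a b C alpha : R) (a0 : 0 < a) (ab : a < b).
Hypotheses (C_gt : (b - a) `^ (- (1 / 2)) < C) (alpha1 : 1 < alpha).

Lemma minimax_risk_ge : exists2 c0 : R, 0 < c0 & forall K n : nat,
  n%:R * (2 * b / a * expR (- (a / (2 * (expR 1 * b + a)) * K%:R))) <= 1 / 2 ->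
  ((c0 * K.+2%:R `^ (- (2 * alpha)))%:E <= minimax_risk b a0 alpha C n)%E.
Proof.
set r := (Num.truncn alpha).+1.
have b0 : 0 < b by apply: lt_trans ab.
have ba : 0 < b - a by rewrite subr_gt0.
have alpha0 : 0 < alpha by apply: lt_trans alpha1.
have [|L L0 fL] := @fdiff_bump R r alpha.
  by rewrite alpha0 ltW// /r -natr1; have := truncn_itv (ltW alpha0) => /andP[_]; rewrite -natr1.
pose s : R := Num.sqrt (b - a).
have s0 : 0 < s by rewrite sqrtr_gt0.
have s2 : s ^+ 2 = b - a by rewrite sqr_sqrtr// ltW.
have Cs : s^-1 < C by move: C_gt; rewrite powRN div1r powR12_sqrt// ltW.
clearbody s.
have si0 : 0 < s^-1 by rewrite invr_gt0.
have C0 : 0 < C by apply: lt_trans Cs.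
have Cs0 : 0 < C - s^-1 by rewrite subr_gt0.
pose W := L * r.+1%:R * 2 * s.
have W0 : 0 < W by rewrite !mulr_gt0.
pose k := (b - a)^-1; have k0 : 0 < k by rewrite invr_gt0.
(* The three terms serve positivity of the perturbed density, its norm and its modulus. *)
pose delta := Num.min (Num.min k ((C - s^-1) / s)) (C / W).
have delta0 : 0 < delta by rewrite !lt_min k0 !divr_gt0.
have delta_k : delta <= k by rewrite /delta !ge_min lexx.
have delta_norm : delta * s <= C - s^-1.
  by rewrite -ler_pdivlMr// /delta !ge_min lexx orbT.
have delta_modulus : delta * W <= C by rewrite -ler_pdivlMr// /delta !ge_min lexx orbT.
clearbody delta.
exists (delta ^+ 2 * (16^-1 ^+ r) ^+ 2 * ((b - a) / 2) / 16).
  by rewrite !mulr_gt0 ?exprn_gt0 ?invr_gt0.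
(* Vanishing moments of orders 0 to [K] are [K.+1] conditions, hence [K.+2] coefficients. *)
move=> K n nK; pose M := K.+2.
pose w := (b - a) / M%:R.
have M0 : 0 < M%:R :> R by rewrite ltr0n.
have M1 : 1 <= M%:R :> R by rewrite ler1n.
have w0 : 0 < w by rewrite divr_gt0.
have [c sum_c orth] := exists_orthogonal_bump_sum ab r K.+1 w0.
pose g := bump_sum r a w c.
have bg : bounded_meas a b g by exact: bounded_meas_bump_sum.
have g0 : lint a b g = 0.
  by rewrite -(orth 0%N)//; congr lint; apply/funext => t; rewrite expr0 mulr1.
pose kappa := delta * M%:R `^ (- alpha).
have kappa0 : 0 < kappa by rewrite mulr_gt0 ?powR_gt0.
(* This is where [alpha > 1] enters: since [g ^+ 2 <= M%:R], it gives [p t ^+ 2 <= kappa ^+ 2 * M%:R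
   <= delta ^+ 2], so [k - p t] stays nonnegative. *)
have kM : kappa * M%:R <= delta.
  rewrite /kappa -mulrA ler_piMr ?(ltW delta0)// powRN mulrC ler_pdivrMr ?powR_gt0//.
  by rewrite mul1r le1r_powR// ltW.
have k_delta : kappa <= delta by apply: le_trans kM; rewrite ler_peMr// ltW.
pose p t := kappa * g t.
have bp : bounded_meas a b p by apply: bounded_measM => //; exact: bounded_meas_cst.
have p_le t : `|p t| <= k.
  apply: le_trans delta_k; rewrite -ler_sqr ?nnegrE ?(ltW delta0)// real_normK ?num_real//.
  rewrite /p exprMn; apply: (@le_trans _ _ (kappa ^+ 2 * M%:R)).
    by rewrite ler_wpM2l ?sqr_ge0// -sum_c; exact: bump_sum_le.
  by rewrite expr2 -mulrA [leRHS]expr2; apply: ler_pM => //; [exact: ltW|rewrite mulr_ge0// ltW].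
have bk := bounded_meas_cst a b k.
have bu1 : bounded_meas a b (fun t => k + (- kappa) * g t).
  by apply: bounded_measD => //; apply: bounded_measM => //; exact: bounded_meas_cst.
have [||f0 f0E] := @H1_of_bounded R a b (fun=> k) k ab bk.1.
- by move=> t _; rewrite lexx ltW.
- by rewrite lintE// lint_cst// mulVf// gt_eqF.
have [||f1 f1E] := @H1_of_bounded R a b (fun t => k + (- kappa) * g t) (2 * k) ab bu1.1.
- move=> t _; have := p_le t; rewrite /p ler_norml mulNr => /andP[h1 h2]; lra.
- rewrite lintE// lintD//; last by apply: bounded_measM => //; exact: bounded_meas_cst.
  by rewrite lintZ// g0 mulr0 addr0 lint_cst// mulVf// gt_eqF.
have smooth (f : L2 a b) (kap : R) : `|kap| <= kappa ->
    {ae leb a b, forall t, f t = k + kap * g t} -> smooth_ball alpha C f.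
  move=> kapk fE; split.
    apply: (@L2norm_perturbation _ a b alpha C delta s K.+1 c) fE => //; first exact: ltW.
    exact: le_trans kapk _.
  by apply: (@modulus_perturbation _ a b alpha C L delta s K.+1 c) fE => //; exact: ltW.
(* The lower bound for the norm of [kappa * g] given by [integral_sqr_bump_sum_ge], as
   [M%:R * (w / 2) = (b - a) / 2]. *)
pose D := kappa * 16^-1 ^+ r * Num.sqrt ((b - a) / 2).
have D2 : D ^+ 2 = kappa ^+ 2 * ((16^-1 ^+ r) ^+ 2 * ((b - a) / 2)).
  by rewrite /D !exprMn sqr_sqrtr ?mulrA// divr_ge0// ltW.
have D0 : 0 <= D by rewrite mulr_ge0 ?sqrtr_ge0// mulr_ge0 ?exprn_ge0// ltW.
set c0 := _ / 16.
have -> : c0 * M%:R `^ (- (2 * alpha)) = D ^+ 2 / 16.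
  have -> : M%:R `^ (- (2 * alpha)) = (M%:R `^ (- alpha)) ^+ 2.
    by rewrite -powR_mulrn ?powR_ge0// -powRrM mulNr (mulrC alpha).
  by rewrite D2 /c0 /kappa; ring.
apply: (@minimax_risk_two_points _ a b a0 n alpha C f0 f1 D
  (2 * b / a * expR (- (a / (2 * (expR 1 * b + a)) * K%:R)))) => //.
- by rewrite mulr_ge0 ?expR_ge0// divr_ge0 ?mulr_ge0// ltW.
- apply: (smooth f0 0); first by rewrite normr0 ltW.
  have fltr := ae_filter_ringOfSetsType (leb a b).
  by apply: filterS f0E => t ->; rewrite mul0r addr0.
- by apply: (smooth f1 (- kappa)); rewrite // normrN ger0_norm// ltW.
- apply: L2norm_ge => //.
  rewrite (@integral_sqr_ae_eq _ a b _ p); last first.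
  + have fltr := ae_filter_ringOfSetsType (leb a b).
    by apply: filterS2 f0E f1E => t /= -> ->; rewrite /p; ring.
  + exact: bp.1.
  + by apply: measurable_funB; exact: measurable_L2_fun.
  have bg2 : bounded_meas a b (fun t => g t ^+ 2) by exact: bounded_measX.
  have := integral_sqr_bump_sum_ge r c ab (ltn0Sn K.+1).
  rewrite (lintE ab bg2) lee_fin sum_c => gL.
  rewrite lintE//; last exact: bounded_measX.
  rewrite (_ : (fun t => p t ^+ 2) = fun t => kappa ^+ 2 * g t ^+ 2); last first.
    by apply/funext => t; rewrite exprMn.
  rewrite lintZ// lee_fin D2 ler_wpM2l ?sqr_ge0//; apply: le_trans gL.
  rewrite ler_wpM2l ?sqr_ge0// [leRHS](_ : _ = (M%:R * w) / 2); last by rewrite mulrA.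
  by rewrite /w mulrCA divff ?mulr1// gt_eqF.
- apply: (mixture_law_close a0 ab f0E _ bp) => //.
  + have fltr := ae_filter_ringOfSetsType (leb a b).
    by apply: filterS f1E => t ->; rewrite mulNr.
  + move=> i iK; rewrite (_ : (fun t => _) = fun t => kappa * (g t * t ^+ i)); last first.
      by apply/funext => t; rewrite mulrA.
    rewrite lintZ ?orth ?mulr0//.
    by apply: bounded_measM => //; apply: bounded_measX; exact: bounded_meas_id.
Qed.

End lower_bound.

Theorem theorem4 (R : realType) (a b C alpha : R) (a_gt0 : 0 < a)
    (a_lt_b : a < b) (C_gt : (b - a) `^ (- (1 / 2)) < C) (alpha_gt1 : 1 < alpha) :
  exists2 Cstar : R, 0 < Cstar &
  exists2 eps : nat -> R, eps n @[n --> \oo] --> (0 : R) &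
  \forall n \near \oo,
    ((Cstar * ln n%:R `^ (- (2 * alpha)) * (1 + eps n))%:E
      <= minimax_risk b a_gt0 alpha C n)%E.
Proof.
have [c0 c0_gt0 lower] := minimax_risk_ge a_gt0 a_lt_b C_gt alpha_gt1.
have b0 : 0 < b by apply: lt_trans a_lt_b.
set tilt := a / (2 * (expR 1 * b + a)) in lower.
have tilt0 : 0 < tilt.
  by rewrite divr_gt0// mulr_gt0// addr_gt0// mulr_gt0// expR_gt0.
(* With [K] above [A * ln n%:R], the exponent [tilt * K%:R] exceeds [2 * ln n%:R]: one power of [n]
   pays for the number of observations, the other for the constant [2 * b / a]. *)
pose A := 2 / tilt; have A0 : 0 < A by rewrite divr_gt0.
(* The number of bumps [K.+2] is at most [A * ln n%:R + 3], hence at most [(A + 3) * ln n%:R] once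
   [ln n%:R >= 1]. *)
exists (c0 * (A + 3) `^ (- (2 * alpha))).
  by rewrite mulr_gt0// powR_gt0// addr_gt0.
(* The bound holds for all large [n] without a correction factor. *)
exists (fun=> 0); first exact: cvg_cst.
near=> n; rewrite addr0 mulr1.
have n_e : expR 1 <= n%:R :> R by near: n; exact: nbhs_infty_ger.
have n_b : 4 * b / a <= n%:R by near: n; exact: nbhs_infty_ger.
have n0 : 0 < n%:R :> R by apply: lt_le_trans n_e; exact: expR_gt0.
have ln1 : 1 <= ln n%:R :> R by rewrite -[leLHS](@expRK R) ler_ln ?posrE ?expR_gt0.
have Aln0 : 0 <= A * ln n%:R by rewrite mulr_ge0 ?(ltW A0)// (le_trans ler01).
(* [n * expR (- (tilt * K))] is then at most [1 / n] *)
pose K := (Num.truncn (A * ln n%:R)).+1.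
have /andP[K_le K_gt] := truncn_itv Aln0.
have nK : n%:R * (2 * b / a * expR (- (tilt * K%:R))) <= 1 / 2.
  have eK : expR (- (tilt * K%:R)) <= n%:R ^- 2.
    rewrite -[n%:R](lnK n0) -expRM_natl -expRN ler_expR lerN2.
    have -> : 2%:R * ln n%:R = tilt * (A * ln n%:R).
      by rewrite /A; field; rewrite gt_eqF.
    by rewrite ler_wpM2l ?(ltW tilt0)// ltW.
  apply: (@le_trans _ _ (n%:R * (2 * b / a * n%:R ^- 2))).
    by rewrite ler_wpM2l ?(ltW n0)// ler_wpM2l// divr_ge0 ?mulr_ge0// ltW.
  have -> : n%:R * (2 * b / a * n%:R ^- 2) = (4 * b / a / n%:R) / 2.
    by field; rewrite !gt_eqF.
  by rewrite ler_wpM2r// ler_pdivrMr// mul1r.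
apply: le_trans (lower K n nK).
rewrite lee_fin -mulrA ler_wpM2l ?(ltW c0_gt0)//.
have A3 : 0 < A + 3 by rewrite addr_gt0.
have ln0 : 0 < ln n%:R :> R by apply: lt_le_trans ln1.
have K2 : K.+2%:R <= (A + 3) * ln n%:R by rewrite /K -!natr1; nra.
rewrite -powRM ?(ltW A3) ?(ltW ln0)// !powRN lef_pV2 ?posrE ?powR_gt0 ?mulr_gt0//.
apply: ge0_ler_powR => //.
- by rewrite mulr_ge0// ltW// (lt_trans ltr01).
- by rewrite nnegrE.
- by rewrite nnegrE mulr_ge0// ltW.
Unshelve. all: by end_near. Qed.
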